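(* Let $p$ be a prime, $n\ge 1$ an integer, and let $G$ be the GGS-group over the $p^n$-adic tree with defining vector $\mathbf{e}\in\mathcal{F}(p^n)$. The following hold: (i) If $\mathbf{e}\notin\mathcal{E}'(2^n)$ (that is, unless $p=2$ and $\mathbf{e}\in\mathcal{E}'(2^n)$), then $G$ is weakly regular branch over $G''$. (ii) If $\mathbf{e}\notin\mathcal{E}(p^n)$, then $G$ is regular branch over $\gamma_3(G)$.
   Context: Let $m=p^n$ and $X=\{x_1,\dots,x_m\}$. The $p^n$-adic tree $\mathcal{T}$ is the rooted tree whose vertices are the words of the free monoid $X^*$ (root: the empty word), with $u$ and $ux$ joined by an edge for $u\in X^*$, $x\in X$; the $\ell$-th level is the set of words of length $\ell$. $\mathrm{Aut}\,\mathcal{T}$ is the group of automorphisms of $\mathcal{T}$; products are composed left to right ($fg$ means first $f$, then $g$), $x^y=y^{-1}xy$, $[x,y]=x^{-1}y^{-1}xy$. For $f\in\mathrm{Aut}\,\mathcal{T}$ and $u\in X^*$, the section $f_u\in\mathrm{Aut}\,\mathcal{T}$ is defined by $f(uz)=f(u)f_u(z)$ for all $z\in X^*$. $\mathrm{st}(1)$ is the pointwise stabilizer of the first level, and $\psi:\mathrm{st}(1)\to(\mathrm{Aut}\,\mathcal{T})^{m}$, $\psi(f)=(f_{x_1},\dots,f_{x_m})$, is an isomorphism. For $G\le\mathrm{Aut}\,\mathcal{T}$ put $\mathrm{st}_G(1)=\mathrm{st}(1)\cap G$. GGS-groups: given a non-zero $\mathbf{e}=(e_1,\dots,e_{p^n-1})\in(\mathbb{Z}/p^n\mathbb{Z})^{p^n-1}$,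 the GGS-group with defining vector $\mathbf{e}$ is $G=\langle a,b\rangle$, where $a$ is the rooted automorphism $a(x_iz)=x_{i+1}z$ (indices modulo $p^n$, $z\in X^*$) and $b\in\mathrm{st}(1)$ is defined recursively by $\psi(b)=(a^{e_1},\dots,a^{e_{p^n-1}},b)$. Branching: $G$ is spherically transitive if it acts transitively on every level, and self-similar if $g_u\in G$ for all $g\in G$, $u\in X^*$. If $G$ is spherically transitive and self-similar and $1\ne K\le\mathrm{st}_G(1)$ satisfies $K\times\overset{m}{\cdots}\times K\subseteq\psi(K)$, then $G$ is weakly regular branch over $K$; if moreover $|G:K|$ is finite, $G$ is regular branch over $K$. $\gamma_i(G)$ denotes the lower central series, $G''=(G')'$. Sets of vectors: $\mathcal{F}(p^n)=(\mathbb{Z}/p^n\mathbb{Z})^{p^n-1}\setminus(p\mathbb{Z}/p^n\mathbb{Z})^{p^n-1}$. For $\mathbf{e}\in\mathcal{F}(p^n)$ let $Y=\{1\le i\le p^n-1\mid e_i\not\equiv0\bmod p\}$ and let $t=t(\mathbf{e})$ be the largest integer $s\ge0$ such that $p^s\mid i$ for all $i\in Y$ (so $0\le t\le n-1$). $Y$ is maximal if $Y=\{p^t,2p^t,\dots,p^n-p^t\}$. $\mathcal{E}(p^n)$ is the set of $\mathbf{e}\in\mathcal{F}(p^n)$ such that $Y$ is maximal and $\mathbf{e}$ is constant modulo $p$ on $Y$; equivalently $e_{ip^t}\equiv e_{jp^t}\bmod p$ for all $1\le i,j\le p^{n-t}-1$. For $p=2$, $\mathcal{E}'(2^n)=\{\mathbf{e}\in\mathcal{F}(2^n)\mid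 t=n-1\}$, i.e. the vectors whose only odd entry is $e_{2^{n-1}}$. *)

(* Defs.v *)
From HB Require Import structures.
From mathcomp Require Import all_boot all_algebra.
From mathcomp Require Import boolp classical_sets cardinality.
Set Implicit Arguments.
Unset Strict Implicit.
Unset Printing Implicit Defensive.

Local Open Scope classical_set_scope.
Local Open Scope group_scope.
Local Open Scope nat_scope.

Section Subgroups.
Variable gT : groupType.
Implicit Types (A H K : set gT).

Definition is_subgroup H : Prop := group_closed [in H].

Definition generated A : set gT :=
  [set g | forall H, is_subgroup H -> A `<=` H -> H g].

Definition commutator H K : set gT :=
  generated [set c | exists h k, [/\ H h, K k & c = [~ h, k]%g]].

Fixpoint lcs (i : nat) H : set gT :=
  if i is j.+1 then commutator (lcs j H) H else H.

(* Indexed from 1: gamma 1 H = H and gamma i.+1 H = [gamma i H, H]. *)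
Definition gamma (i : nat) H : set gT := lcs i.-1 H.

Definition derived H : set gT := commutator H H.

Definition finite_index H K : Prop :=
  finite_set [set C | exists2 g, H g & C = [set (k * g)%g | k in K]].

End Subgroups.

Section Tree.
Variable m : nat.

(* The letter x_i of the alphabet is the ordinal of value i - 1. *)
Definition word := seq 'I_m.

Definition adjacent (u v : word) : Prop :=
  (exists x, v = rcons u x) \/ (exists x, u = rcons v x).

Definition is_tree_aut (f : word -> word) : Prop :=
  [/\ bijective f, f [::] = [::]
    & forall u v, adjacent (f u) (f v) <-> adjacent u v].

Record aut := Aut { aut_fun :> word -> word; autP : is_tree_aut aut_fun }.

Lemma aut_ext (f g : aut) : f =1 g -> f = g.
Proof.
case: f g => [f fP] [g gP] /= /funext fg; case: _ / fg gP => gP.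
by congr Aut; exact: Prop_irrelevance.
Qed.

Definition child_pres (f : word -> word) :=
  forall u x, exists y, f (rcons u x) = rcons (f u) y.

Lemma child_pres_aut (f g : word -> word) : cancel f g -> cancel g f ->
  f [::] = [::] -> child_pres f -> child_pres g -> is_tree_aut f.
Proof.
move=> fK gK f0 cf cg; split=> //; first by exists g.
move=> u v; split=> -[] [x E].
- by left; have [y] := cg (f u) x; rewrite -E !fK => ->; exists y.
- by right; have [y] := cg (f v) x; rewrite -E !fK => ->; exists y.
- by left; have [y] := cf u x; rewrite -E => ->; exists y.
- by right; have [y] := cf v x; rewrite -E => ->; exists y.
Qed.

Lemma aut_child (f : aut) : child_pres f.
Proof.
have [fbij f0 fadj] := autP f; elim/last_ind => [|u z IH] x.
  have : adjacent (f [::]) (f (rcons [::] x)) by apply/fadj; left; exists x.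
  by rewrite f0 => -[] // -[y /(congr1 size)]; rewrite size_rcons.
have : adjacent (f (rcons u z)) (f (rcons (rcons u z) x)).
  by apply/fadj; left; exists x.
case=> // -[y]; have [z' ->] := IH z => /rcons_inj -[/(bij_inj fbij)].
by move=> /(congr1 size)/eqP; rewrite !size_rcons ltn_eqF// ltnW.
Qed.

Lemma aut_nil (f : aut) : f [::] = [::].
Proof. by have [] := autP f. Qed.

Lemma size_aut (f : aut) u : size (f u) = size u.
Proof.
elim/last_ind: u => [|u x IH]; first by rewrite aut_nil.
by have [y ->] := aut_child f u x; rewrite !size_rcons IH.
Qed.

Lemma aut_cat (f : aut) u z : take (size u) (f (u ++ z)) = f u.
Proof.
elim/last_ind: z => [|z x IH].
  by rewrite cats0 -(size_aut f) take_size.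
rewrite -rcons_cat; have [y ->] := aut_child f (u ++ z) x.
by rewrite -cats1 takel_cat// size_aut size_cat leq_addr.
Qed.

Fact aut_inv_exists (f : aut) : exists g, cancel f g /\ cancel g f.
Proof. by have [[g fK gK] _ _] := autP f; exists g. Qed.

Definition aut_inv_fun (f : aut) : word -> word := sval (cid (aut_inv_exists f)).

Lemma aut_funK (f : aut) : cancel f (aut_inv_fun f).
Proof. by rewrite /aut_inv_fun; case: cid => g []. Qed.

Lemma aut_inv_funK (f : aut) : cancel (aut_inv_fun f) f.
Proof. by rewrite /aut_inv_fun; case: cid => g []. Qed.

Fact aut_inv_proof f : is_tree_aut (aut_inv_fun f).
Proof.
split; first exact: Bijective (aut_inv_funK f) (aut_funK f).
  by apply: (can_inj (aut_funK f)); rewrite aut_inv_funK aut_nil.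
move=> u v; have [_ _ fadj] := autP f.
by split=> [/fadj|uv]; [|apply/fadj]; rewrite !aut_inv_funK.
Qed.

Fact aut_one_proof : is_tree_aut id.
Proof. by split=> //; exists id. Qed.

(* Products are composed from left to right. *)
Fact aut_mul_proof (f g : aut) : is_tree_aut (g \o f).
Proof.
have [fb f0 fa] := autP f; have [gb g0 ga] := autP g.
split; first exact: bij_comp.
- by rewrite /= f0.
- by move=> u v; rewrite /= ga.
Qed.

Definition aut_one := Aut aut_one_proof.
Definition aut_mul f g := Aut (aut_mul_proof f g).
Definition aut_inv f := Aut (aut_inv_proof f).

HB.instance Definition _ := gen_eqMixin aut.
HB.instance Definition _ := gen_choiceMixin aut.

Fact aut_mulA : associative aut_mul.
Proof. by move=> f g h; apply: aut_ext. Qed.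
Fact aut_mul1 : left_id aut_one aut_mul.
Proof. by move=> f; apply: aut_ext. Qed.
Fact aut_mulr1 : right_id aut_one aut_mul.
Proof. by move=> f; apply: aut_ext. Qed.
Fact aut_mulV : left_inverse aut_one aut_inv aut_mul.
Proof. by move=> f; apply: aut_ext => u /=; rewrite aut_inv_funK. Qed.
Fact aut_mulrV : right_inverse aut_one aut_inv aut_mul.
Proof. by move=> f; apply: aut_ext => u /=; rewrite aut_funK. Qed.

HB.instance Definition _ := isGroup.Build aut
  aut_mulA aut_mul1 aut_mulr1 aut_mulV aut_mulrV.

Definition section_fun (f : aut) (u z : word) : word :=
  drop (size u) (f (u ++ z)).

Lemma section_funE (f : aut) u z : f (u ++ z) = f u ++ section_fun f u z.
Proof. by rewrite -(aut_cat f u z) cat_take_drop. Qed.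

Lemma section_funK (f : aut) u :
  cancel (section_fun f u) (section_fun (aut_inv f) (f u)).
Proof.
by move=> z; rewrite /(section_fun _ (f u)) -section_funE /= aut_funK size_aut
  drop_size_cat.
Qed.

Lemma section_child (f : aut) u : child_pres (section_fun f u).
Proof.
move=> z x; rewrite /section_fun -rcons_cat.
have [y ->] := aut_child f (u ++ z) x; exists y.
by rewrite drop_rcons// size_aut size_cat leq_addr.
Qed.

Fact section_proof (f : aut) u : is_tree_aut (section_fun f u).
Proof.
apply: (child_pres_aut (g := section_fun (aut_inv f) (f u))).
- exact: section_funK.
- have fiK : aut_inv f (f u) = u by rewrite /= aut_funK.
  have fii : aut_inv (aut_inv f) = f.
    apply: aut_ext => v; apply: (can_inj (aut_funK (aut_inv f))).
    by rewrite [LHS](aut_inv_funK (aut_inv f)) /= aut_funK.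
  by have := section_funK (aut_inv f) (f u); rewrite fiK fii.
- by rewrite /section_fun cats0 -(size_aut f) drop_size.
- exact: section_child.
- exact: section_child.
Qed.

Definition tsection (f : aut) (u : word) : aut := Aut (section_proof f u).

Lemma tsectionE (f : aut) u z : f (u ++ z) = f u ++ tsection f u z.
Proof. exact: section_funE. Qed.

Definition st1 : set aut := [set f | forall x, f [:: x] = [:: x]].

Definition psi (f : aut) : 'I_m -> aut := fun x => tsection f [:: x].

Definition spherically_transitive (G : set aut) : Prop :=
  forall l (u v : word), size u = l -> size v = l -> exists2 g, G g & g u = v.

Definition self_similar (G : set aut) : Prop :=
  forall g u, G g -> G (tsection g u).

Definition weakly_regular_branch (G K : set aut) : Prop :=
  [/\ spherically_transitive G,
      self_similar G,
      is_subgroup K /\ K `<=` st1 `&` G,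
      K <> [set 1%g]
    & [set h : 'I_m -> aut | forall x, K (h x)] `<=` psi @` K].

Definition regular_branch (G K : set aut) : Prop :=
  weakly_regular_branch G K /\ finite_index G K.

Definition rooted_shift_fun (w : word) : word :=
  if w is x :: z then ordS x :: z else [::].

Fact rooted_shift_proof : is_tree_aut rooted_shift_fun.
Proof.
apply: (child_pres_aut
  (g := fun w : word => if w is x :: z then ord_pred x :: z else [::])) => //.
- by case=> //= x z; rewrite ordSK.
- by case=> //= x z; rewrite ord_predK.
- by case=> [|y u] x; [exists (ordS x) | exists x].
- by case=> [|y u] x; [exists (ord_pred x) | exists x].
Qed.

Definition ggs_a : aut := Aut rooted_shift_proof.

Section GGS.
Variable e : m.-1.-tuple 'Z_m.

(* The entry e_i of the defining vector, for 1 <= i <= m - 1. *)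
Definition entry (i : nat) : 'Z_m := nth 0%R e i.-1.

(* The letter x corresponds to the index i = x.+1; powers of a are taken along
   representatives in nat of the exponents, a having order m. *)
Fixpoint ggs_b_fun (w : word) : word :=
  if w is x :: z then
    x :: (if x.+1 == m then ggs_b_fun z else (ggs_a ^+ entry x.+1)%g z)
  else [::].

Fixpoint ggs_b_inv_fun (w : word) : word :=
  if w is x :: z then
    x :: (if x.+1 == m then ggs_b_inv_fun z else (ggs_a ^- entry x.+1)%g z)
  else [::].

Fact ggs_b_proof : is_tree_aut ggs_b_fun.
Proof.
have inv0 (g : aut) : aut_inv_fun g [::] = [::] := aut_nil (aut_inv g).
have invc (g : aut) : child_pres (aut_inv_fun g) := aut_child (aut_inv g).
apply: (child_pres_aut (g := ggs_b_inv_fun)) => //.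
- elim=> //= x z IH; congr (_ :: _); case: (x.+1 == m) => //; exact: aut_funK.
- elim=> //= x z IH; congr (_ :: _); case: (x.+1 == m) => //; exact: aut_inv_funK.
- elim=> [|y u IH] x; first by exists x => /=; case: ifP; rewrite ?aut_nil.
  rewrite rcons_cons /=; case: ifP => _.
    by have [y' ->] := IH x; exists y'.
  by have [y' ->] := aut_child (ggs_a ^+ entry y.+1)%g u x; exists y'.
- elim=> [|y u IH] x; first by exists x => /=; case: ifP; rewrite ?inv0.
  rewrite rcons_cons /=; case: ifP => _.
    by have [y' ->] := IH x; exists y'.
  by have [y' ->] := invc (ggs_a ^+ entry y.+1)%g u x; exists y'.
Qed.

Definition ggs_b : aut := Aut ggs_b_proof.

Lemma ggs_b_st1 : st1 ggs_b.
Proof. by move=> x /=; case: ifP; rewrite ?aut_nil. Qed.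

Lemma psi_ggs_b x :
  psi ggs_b x = if x.+1 == m then ggs_b else (ggs_a ^+ entry x.+1)%g.
Proof.
by apply: aut_ext => z; rewrite /= /section_fun /= drop0; case: ifP.
Qed.

Definition GGS : set aut := generated [set ggs_a; ggs_b].

End GGS.
End Tree.

Section Vectors.
Variables p n : nat.
Implicit Type e : (p ^ n).-1.-tuple 'Z_(p ^ n).

Definition Fset e : Prop :=
  ~ (forall i, 0 < i < p ^ n -> p %| (entry e i : nat)).

Definition Yset e : set nat :=
  [set i | 0 < i < p ^ n /\ ~~ (p %| (entry e i : nat))].

(* When Y is non-empty (that is, on Fset) every s with p ^ s dividing Y is
   smaller than n, so the bound s < n does not restrict the maximum. *)
Definition texp e : nat :=
  \max_(s < n | `[< forall i, Yset e i -> p ^ s %| i >]) s.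

Definition Ymaximal e : Prop :=
  Yset e = [set i | exists2 k, 0 < k < p ^ (n - texp e) & i = k * p ^ texp e].

Definition Eset e : Prop :=
  [/\ Fset e, Ymaximal e
    & forall i j, Yset e i -> Yset e j -> entry e i = entry e j %[mod p]].

(* Only meaningful for p = 2. *)
Definition Eprime e : Prop := Fset e /\ texp e = n.-1.

End Vectors.

(* Main.v *)
Require Import Defs.
From mathcomp Require Import all_boot all_algebra.
From mathcomp Require Import all_field.
From mathcomp Require Import ring zify.
From mathcomp Require Import boolp classical_sets cardinality.
Set Implicit Arguments.
Unset Strict Implicit.
Unset Printing Implicit Defensive.

Import GRing.Theory.

(** For each letter x, some conjugate b_x of b by a power of a has section b at x.
    Its section at any other letter y is a power of a, with exponent the entry
    e_(y - x), indices being read modulo m = p^n. Hence [b_x, b_y] has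
    sections [b, a^e_(x-y)] at x, [a^e_(y-x), b] at y, and trivial ones
    elsewhere. An entry e_r prime to p makes a^e_r a generator of <a>, so that
    [b, a^e_r] generates G' as a normal subgroup, and st_G(1) projects onto G at
    every letter (psi_onto). Hence a normal subgroup of G consisting of sections
    at the letter 0 of elements with prescribed support contains G' as soon as
    it contains such a commutator.

    Part (i). Outside E'(2^n) some unit entry e_i has i <> -i. The commutator
    [b_0, b_(-i)] shows that every element of G' is the section at 0 of an
    element of G' supported on {0, -i}. Correcting [b_i, b_0] at 0 by such an
    element leaves a support {i, -i}; a conjugation by a power of a turns it
    into {0, -2i}. As -i and -2i differ, commutators of elements of the two
    kinds live at 0 alone, and their sections there exhaust G''
    (derived2_rist). That G'' is not trivial comes from the sections at 0 of two
    elements of G' which do not commute (derived2_neq1).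

    Part (ii). Let A be the group of sections at 0 of the elements of gamma_3(G)
    supported at 0, and Z the centraliser of G' modulo A. One has G'' <= A by
    part (i), since an i as above exists outside E(p^n) too (rigid_of_involutive).
    So G' <= Z, and gamma_3(G) <= A means Z = G. The key fact
    (centralizer_shift) is that, for w in st_G(1) and e_r prime to p, if the
    section of w at 0 is in Z, then so is its section at r: the commutator of
    [b_r, b_0] with w has at 0 a section in A, which can be removed, and what is
    left at r has to be in A.

    One descends along q = p^l, assuming a^(qp) and b^(qp) to be in Z. The pairs
    (x, y) with a^(qx) b^(qy) in Z then form a subspace V of F_p^2. Feeding words
    in the b_x^q to the key fact yields closure properties of V. If V is a proper
    subspace, it contains neither (1, 0) nor (0, 1), and there is a single c with
    e_(-r) e_(r+s) = c e_s modulo p for e_r prime to p and s <> 0, -r. Then e / c,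
    given the value 1 at 0, turns the addition of an index in Y into a product;
    as m times an index is 0 and x^m = x in F_p, it takes the value 1 on Y
    (E_constant_closed). So the vector is constant on Y modulo p, and Y with 0 is a
    subgroup of Z/m, which is membership in E(p^n) (rigid_Eset). So if e is not
    in E(p^n), the descent goes from l = n, where a^m = b^m = 1, down to l = 0,
    and Z = G. The index of gamma_3(G) is finite because G is generated by two
    elements of finite order (gamma3_finite_index). *)

(** * Subgroups and commutators *)

Section Groups.
Local Open Scope classical_set_scope.
Local Open Scope group_scope.
Variable gT : groupType.
Implicit Types (A B G H K N : set gT) (g h x y z : gT) (k : nat).

Lemma is_subgroupP H :
  is_subgroup H <-> H 1 /\ (forall x y, H x -> H y -> H (x * y^-1)).
Proof.
split=> [[]|[H1 Hd]].
- rewrite inE => H1 Hd; split=> // x y Hx Hy.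
  by have := Hd x y; rewrite !inE; apply.
- by split=> [|x y]; rewrite !inE //; apply: Hd.
Qed.

Section Subgroup.
Variable H : set gT.
Hypothesis sH : is_subgroup H.

Lemma subgroup1 : H 1.
Proof. by have [] := (is_subgroupP H).1 sH. Qed.

Lemma subgroupV x : H x -> H x^-1.
Proof.
have [H1 Hd] := (is_subgroupP H).1 sH.
by move=> Hx; rewrite -[x^-1]mul1g; apply: Hd.
Qed.

Lemma subgroupM x y : H x -> H y -> H (x * y).
Proof.
have [H1 Hd] := (is_subgroupP H).1 sH.
by move=> Hx Hy; rewrite -[y]invgK; apply: Hd => //; apply: subgroupV.
Qed.

Lemma subgroupX x n : H x -> H (x ^+ n).
Proof.
move=> Hx; elim: n => [|n IHn]; rewrite ?expg0 ?expgS; first exact: subgroup1.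
exact: subgroupM.
Qed.

Lemma subgroupJ x y : H x -> H y -> H (x ^ y).
Proof.
move=> Hx Hy; rewrite conjgE.
exact: subgroupM (subgroupV Hy) (subgroupM Hx Hy).
Qed.

Lemma subgroupR x y : H x -> H y -> H [~ x, y].
Proof.
move=> Hx Hy; rewrite commgEl.
exact: subgroupM (subgroupV Hx) (subgroupJ Hx Hy).
Qed.

Lemma subgroupMl x y : H x -> H (x * y) -> H y.
Proof.
by move=> Hx Hxy; rewrite -(mulKg x y); apply: subgroupM => //; apply: subgroupV.
Qed.

Lemma subgroupMr x y : H y -> H (x * y) -> H x.
Proof.
by move=> Hy Hxy; rewrite -(mulgK y x); apply: subgroupM => //; apply: subgroupV.
Qed.

End Subgroup.

Lemma mk_subgroup H : H 1 -> (forall x y, H x -> H y -> H (x * y)) ->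
  (forall x, H x -> H x^-1) -> is_subgroup H.
Proof.
by move=> H1 HM HV; apply/is_subgroupP; split=> // x y Hx Hy; apply/HM/HV.
Qed.

Lemma generated_subgroup A : is_subgroup (generated A).
Proof.
apply: mk_subgroup => [H sH _|x y Ax Ay H sH AH|x Ax H sH AH].
- exact: subgroup1.
- by apply: subgroupM => //; [exact: Ax|exact: Ay].
- by apply: subgroupV => //; apply: Ax.
Qed.

Lemma mem_generated A x : A x -> generated A x.
Proof. by move=> Ax H _; apply. Qed.

Lemma generated_sub A H : is_subgroup H -> A `<=` H -> generated A `<=` H.
Proof. by move=> sH AH x; apply. Qed.

Definition normal_in G N :=
  [/\ is_subgroup N, N `<=` G & forall x g, N x -> G g -> N (x ^ g)].

Lemma mem_commutator H K h x : H h -> K x -> commutator H K [~ h, x].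
Proof. by move=> Hh Kx; apply: mem_generated; exists h, x. Qed.

Lemma commutator_sub H K N : is_subgroup N ->
  (forall h x, H h -> K x -> N [~ h, x]) -> commutator H K `<=` N.
Proof. by move=> sN HKN; apply: generated_sub => // x [h [k [? ? ->]]]; apply: HKN. Qed.

Lemma normal_in_refl G : is_subgroup G -> normal_in G G.
Proof. by move=> sG; split=> // x g; apply: subgroupJ. Qed.

Lemma conj_subgroup N g : is_subgroup N -> is_subgroup [set x | N (x ^ g)].
Proof.
move=> sN; apply: mk_subgroup => /= [|x y|x].
- by rewrite conj1g; apply: subgroup1.
- by rewrite conjMg; apply: subgroupM.
- by rewrite conjVg; apply: subgroupV.
Qed.

Lemma commutator_normal G H K : is_subgroup G ->
  normal_in G H -> normal_in G K -> normal_in G (commutator H K).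
Proof.
move=> sG [sH HG nH] [sK KG nK]; split; first exact: generated_subgroup.
  by apply: commutator_sub => // h k /HG Gh /KG Gk; apply: subgroupR.
move=> x g + Gg; move: x; apply: commutator_sub.
  exact/conj_subgroup/generated_subgroup.
move=> h k Hh Kk /=; rewrite conjRg; apply: mem_commutator; [exact: nH|exact: nK].
Qed.

Lemma derived_normal G : is_subgroup G -> normal_in G (derived G).
Proof. by move=> sG; apply: commutator_normal => //; apply: normal_in_refl. Qed.

Lemma gamma3_normal G : is_subgroup G -> normal_in G (gamma 3 G).
Proof.
move=> sG; apply: commutator_normal => //; last exact: normal_in_refl.
exact: derived_normal.
Qed.

Lemma derived2_normal G : is_subgroup G -> normal_in G (derived (derived G)).
Proof. by move=> sG; apply: commutator_normal => //; exact: derived_normal. Qed.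

Lemma derived2_sub_gamma3 G : is_subgroup G ->
  derived (derived G) `<=` gamma 3 G.
Proof.
move=> sG; have [_ G'G _] := derived_normal sG.
apply: commutator_sub; first exact: generated_subgroup.
by move=> h k Hh /G'G Gk; apply: mem_commutator.
Qed.

(** The preimage of the centraliser of the image of B in G / N. *)
Definition centmod G N B : set gT := [set z | G z /\ forall h, B h -> N [~ h, z]].

Lemma commgMr x y z : [~ x, y * z] = [~ x, z] * [~ x, y] ^ z.
Proof. by rewrite /commg !conjgE !invgM !mulgA !mulgK. Qed.

Lemma commgMl x y z : [~ x * y, z] = [~ x, z] ^ y * [~ y, z].
Proof. by rewrite /commg !conjgE !invgM !mulgA !mulgK. Qed.

Lemma commgVr x y : [~ x, y^-1] = ([~ x, y] ^ y^-1)^-1.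
Proof. by rewrite /commg !conjgE !invgM !invgK !mulgA mulgV mul1g. Qed.

Lemma commgVl x y : [~ x^-1, y] = ([~ x, y] ^ x^-1)^-1.
Proof. by rewrite -invgR commgVr invgK -conjVg invgR. Qed.

Lemma centmod_subgroup G N B : is_subgroup G -> normal_in G N ->
  is_subgroup (centmod G N B).
Proof.
move=> sG [sN NG nN]; apply: mk_subgroup.
- by split=> [|h Bh]; [exact: subgroup1|rewrite commg1; exact: subgroup1].
- move=> x y [Gx Nx] [Gy Ny]; split=> [|h Bh]; first exact: subgroupM.
  by rewrite commgMr; apply: subgroupM => //; [exact: Ny|apply: nN => //; exact: Nx].
- move=> x [Gx Nx]; split=> [|h Bh]; first exact: subgroupV.
  by rewrite commgVr; apply: subgroupV => //; apply: nN; [exact: Nx|exact: subgroupV].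
Qed.

Lemma centmod_normal G N B : is_subgroup G -> normal_in G N -> normal_in G B ->
  normal_in G (centmod G N B).
Proof.
move=> sG NN NB; split; first exact: centmod_subgroup.
  by move=> x [].
have [sN NG nN] := NN; have [sB BG nB] := NB.
move=> x g [Gx Nx] Gg; split=> [|h Bh]; first exact: subgroupJ.
rewrite -(conjgKV g h) -conjRg; apply: nN => //; apply: Nx.
by apply: nB => //; apply: subgroupV.
Qed.

(** G is generated by z and w, as an induction principle. *)
(** An induction principle rather than an equation, so that one group can be fed
    with several pairs of generators. *)
Definition gen2 G z w := forall H, is_subgroup H -> H z -> H w -> G `<=` H.

(** Modulo N the generators commute. One passes from the generators to G by
    noting that the centralisers modulo N of z, of w and then of G are subgroups
    containing z and w. *)
Lemma gen2_derived_sub G N z w : is_subgroup G -> gen2 G z w -> G z -> G w ->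
  normal_in G N -> N [~ z, w] -> derived G `<=` N.
Proof.
move=> sG gen Gz Gw NN Nzw; have [sN NG nN] := NN.
have Cz : G `<=` centmod G N [set z].
  apply: gen; first exact: centmod_subgroup.
    by split=> // h ->; rewrite commgg; apply: subgroup1.
  by split=> // h ->.
have Cw : G `<=` centmod G N [set w].
  apply: gen; first exact: centmod_subgroup.
    by split=> // h ->; rewrite -invgR; apply: subgroupV.
  by split=> // h ->; rewrite commgg; apply: subgroup1.
have CG : G `<=` centmod G N G.
  apply: gen; first exact: centmod_subgroup.
    by split=> // h /Cz [_ /(_ z erefl)] /(subgroupV sN); rewrite invgR.
  by split=> // h /Cw [_ /(_ w erefl)] /(subgroupV sN); rewrite invgR.
by apply: commutator_sub => // h k Gh /CG [_]; apply.
Qed.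

Section Congruence.
Variables G N : set gT.
Hypotheses (sG : is_subgroup G) (NN : normal_in G N).

Definition eqm x y := N (x * y^-1).

Let sN : is_subgroup N. Proof. by case: NN. Qed.

Lemma eqm_refl x : eqm x x.
Proof. by rewrite /eqm mulgV; apply: subgroup1. Qed.

Lemma eqm_sym x y : eqm x y -> eqm y x.
Proof. by move=> /(subgroupV sN); rewrite /eqm invgM invgK. Qed.

Lemma eqm_trans y x z : eqm x y -> eqm y z -> eqm x z.
Proof. by rewrite /eqm => xy yz; rewrite -(mulgVK y x) -mulgA; apply: subgroupM. Qed.

Lemma eqmM x x' y y' : G x -> eqm x x' -> eqm y y' -> eqm (x * y) (x' * y').
Proof.
have [_ NG nN] := NN; move=> Gx xx' yy'.
have -> : eqm (x * y) (x' * y') = N ((y * y'^-1) ^ x^-1 * (x * x'^-1)).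
  by congr N; rewrite conjgE !invgM !invgK !mulgA mulgVK.
by apply: subgroupM => //; apply: nN => //; apply: subgroupV.
Qed.

Lemma eqmV x x' : G x -> eqm x x' -> eqm x^-1 x'^-1.
Proof.
have [_ NG nN] := NN; move=> Gx /(subgroupV sN) xx'; rewrite /eqm invgK.
have -> : x^-1 * x' = (x * x'^-1)^-1 ^ x by rewrite conjgE !invgM !invgK mulgVK.
exact: nN.
Qed.

Lemma eqm_mem x y : eqm x y -> N x <-> N y.
Proof.
rewrite /eqm => xy; split=> [Nx|Ny]; last exact: subgroupMr (subgroupV sN Ny) xy.
by rewrite -[y]invgK; exact: (subgroupV sN (subgroupMl sN Nx xy)).
Qed.

Lemma eqm_in x y : eqm x y -> N y -> N x.
Proof. by move=> xy Ny; apply/(eqm_mem xy). Qed.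

Lemma eqm1 x : N x -> eqm x 1.
Proof. by rewrite /eqm invg1 mulg1. Qed.

Lemma eqm_comm x y : N [~ y, x] -> G x -> G y -> eqm (y * x) (x * y).
Proof.
have [_ NG nN] := NN; move=> Nyx Gx Gy; rewrite commgC /eqm.
have -> : x * y * [~ y, x] / (x * y) = [~ y, x] ^ (x * y)^-1.
  by rewrite conjgE invgK !mulgA.
by apply: nN => //; apply: subgroupV => //; apply: subgroupM.
Qed.

Lemma eqmJ x y : N [~ x, y] -> G x -> eqm (x ^ y) x.
Proof.
have [_ NG nN] := NN; move=> Nxy Gx; rewrite /eqm.
have -> : x ^ y * x^-1 = [~ x, y] ^ x^-1.
  by rewrite /commg /conjg invgK !mulgA mulgV mul1g.
by apply: nN => //; apply: subgroupV.
Qed.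

End Congruence.

Section FiniteIndex.
Variables (G : set gT) (a b : gT) (m : nat).
Hypotheses (sG : is_subgroup G) (gen : gen2 G a b) (Ga : G a) (Gb : G b).
Hypotheses (m_gt0 : (0 < m)%N) (am : a ^+ m = 1) (bm : b ^+ m = 1).

Lemma expg_inv_mod x k : x ^+ m = 1 -> (x ^+ k)^-1 = x ^+ (k * m.-1).
Proof.
move=> xm; apply: mulg1_eq; rewrite -expgnDr -mulnS prednK //.
by rewrite mulnC expgnA xm expg1n.
Qed.

(** In the abelian quotient G / N words in the two generators can be sorted;
    inverses are powers, as the generators have finite order. *)
Lemma gen2_mod_derived N g : normal_in G N -> derived G `<=` N -> G g ->
  exists i j, eqm N g (a ^+ i * b ^+ j).
Proof.
move=> NN dN; have [sN NG nN] := NN.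
have comm x y : G x -> G y -> eqm N (x * y) (y * x).
  by move=> Gx Gy; apply: (eqm_comm sG NN) => //; apply: dN; apply: mem_commutator.
move=> Gg.
suff : G `<=` [set h | G h /\ exists i j, eqm N h (a ^+ i * b ^+ j)].
  by move=> /(_ g Gg) [].
apply: gen.
- apply: mk_subgroup.
  + by split; [exact: subgroup1|exists 0%N, 0%N; rewrite mulg1; exact: (eqm_refl NN)].
  + move=> x y [Gx [i [j xij]]] [Gy [i' [j' yij]]]; split; first exact: subgroupM.
    exists (i + i')%N, (j + j')%N.
    apply: (eqm_trans NN (eqmM sG NN Gx xij yij)).
    rewrite !expgnDr -!mulgA; apply: (eqmM sG NN); [exact: subgroupX|exact: eqm_refl NN _|].
    rewrite !mulgA; apply: (eqmM sG NN); last exact: (eqm_refl NN).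
      by apply: subgroupM; rewrite //; apply: subgroupX.
    by apply: comm; apply: subgroupX.
  + move=> x [Gx [i [j xij]]]; split; first exact: subgroupV.
    exists (i * m.-1)%N, (j * m.-1)%N.
    apply: (eqm_trans NN (eqmV NN Gx xij)); rewrite invgM.
    by rewrite !expg_inv_mod //; apply: comm; apply: subgroupX.
- by split=> //; exists 1%N, 0%N; rewrite expg1 mulg1; exact: (eqm_refl NN).
- by split=> //; exists 0%N, 1%N; rewrite expg1 mul1g; exact: (eqm_refl NN).
Qed.


(** G / G' is generated by two commuting elements of finite order, and
    G' / gamma_3 by the class of c = [a, b], for which c^m is congruent to
    [a, b^m] = 1. *)
Lemma gamma3_finite_index : finite_index G (gamma 3 G).
Proof.
pose N := gamma 3 G; pose c := [~ a, b].
have NN : normal_in G N by exact: gamma3_normal.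
have [sN NG nN] := NN.
have [_ dG nd] := derived_normal sG.
have cent d g : derived G d -> G g -> N [~ d, g] by move=> *; exact: mem_commutator.
have dc : derived G c by exact: mem_commutator.
have Gc : G c by exact: dG.
have abk k : eqm N [~ a, b ^+ k] (c ^+ k).
  elim: k => [|k IHk]; first by rewrite commg1; exact: (eqm_refl NN).
  rewrite expgSr expgS commgMr; apply: (eqmM sG NN) => //.
    exact: (eqm_refl NN).
  apply: (eqm_trans NN _ IHk).
  have dk : derived G [~ a, b ^+ k] by apply: mem_commutator => //; exact: subgroupX.
  by apply: (eqmJ sG NN); [exact: cent|exact: dG].
have cm : N (c ^+ m).
  by apply/(eqm_mem NN (abk m)); rewrite bm commg1; apply: subgroup1.
have [sd _ _] := derived_normal sG.
have dGk : derived G `<=` [set g | derived G g /\ exists k, eqm N g (c ^+ k)].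
  apply: (gen2_derived_sub sG gen) => //; last first.
    by split=> //; exists 1%N; exact: (eqm_refl NN).
  split=> [|x [/dG]//|x g [dx [k xk]] Gg].
    apply: mk_subgroup.
    - by split; [exact: (subgroup1 sd)|exists 0%N; exact: (eqm_refl NN)].
    - move=> x y [dx [k xk]] [dy [l yl]]; split; first exact: (subgroupM sd).
      by exists (k + l)%N; rewrite expgnDr; apply: (eqmM sG NN) => //; exact: dG.
    - move=> x [dx [k xk]]; split; first exact: (subgroupV sd).
      exists (k * m.-1)%N; apply: (eqm_trans NN (eqmV NN (dG _ dx) xk)).
      rewrite /eqm -invgM -expgnDr addnC -mulnS prednK // mulnC expgnA.
      exact: (subgroupV sN (subgroupX sN _ cm)).
  split; first exact: nd.
  exists k; apply: (eqm_trans NN _ xk).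
  by apply: (eqmJ sG NN); [exact: cent|exact: dG].
pose F (t : 'I_m * 'I_m * 'I_m) : set gT :=
  [set h * (c ^+ t.2 * (a ^+ t.1.1 * b ^+ t.1.2)) | h in N].
apply: (@sub_finite_set _ _ (range F)); last exact: finite_image.
move=> _ [g Gg ->].
have [i [j gij]] := gen2_mod_derived (derived_normal sG) (fun x dx => dx) Gg.
have [_ [k dk]] := dGk _ gij.
have mod_lt l : (l %% m < m)%N by rewrite ltn_mod.
exists (Ordinal (mod_lt i), Ordinal (mod_lt j), Ordinal (mod_lt k)) => //.
have Gab : G (a ^+ i * b ^+ j) by apply: subgroupM => //; apply: subgroupX.
have expm x l : G x -> N (x ^+ m) -> eqm N (x ^+ (l %% m)) (x ^+ l).
  move=> Gx xm; rewrite [in X in eqm _ _ X](divn_eq l m) expgnDr mulnC expgnA.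
  rewrite -[X in eqm _ X _]mul1g; apply: (eqmM sG NN); first exact: subgroup1.
    by apply: (eqm_sym NN); exact: (eqm1 (subgroupX sN _ xm)).
  exact: (eqm_refl NN).
have gF : eqm N g (c ^+ (k %% m) * (a ^+ (i %% m) * b ^+ (j %% m))).
  have am1 : N (a ^+ m) by rewrite am; apply: (subgroup1 sN).
  have bm1 : N (b ^+ m) by rewrite bm; apply: (subgroup1 sN).
  rewrite -[g](mulgVK (a ^+ i * b ^+ j)); apply: (eqmM sG NN).
  - by apply: subgroupM => //; apply: subgroupV.
  - by apply: (eqm_trans NN dk); apply: (eqm_sym NN); apply: expm.
  - apply: (eqmM sG NN); first exact: subgroupX.
      by apply: (eqm_sym NN); apply: expm.
    by apply: (eqm_sym NN); apply: expm.
rewrite /F /=; set f := c ^+ _ * _ in gF *.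
apply/seteqP; split=> _ [h Nh <-].
  exists (h * (f * g^-1)); last by rewrite -!mulgA mulVg mulg1.
  by apply: (subgroupM sN) => //; have := subgroupV sN gF; rewrite invgM invgK.
by exists (h * (g * f^-1)); [apply: (subgroupM sN)|rewrite -!mulgA mulVg mulg1].
Qed.

End FiniteIndex.

End Groups.

(** * Sections of tree automorphisms *)

Section TreeSections.
Local Open Scope classical_set_scope.
Local Open Scope group_scope.
Variable m : nat.
Implicit Types (f g h : aut m) (x y : 'I_m) (u v z : word m) (G N : set (aut m)).

Lemma autME f g u : (f * g) u = g (f u).
Proof. by []. Qed.

Lemma tsection_eq f g u : (forall z, f (u ++ z) = f u ++ g z) -> tsection f u = g.
Proof.
move=> fg; apply: aut_ext => z; have := fg z; rewrite tsectionE => /eqP.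
by rewrite eqseq_cat // eqxx => /eqP.
Qed.

Lemma tsectionM f g u : tsection (f * g) u = tsection f u * tsection g (f u).
Proof. by apply: tsection_eq => z; rewrite !autME tsectionE (tsectionE g). Qed.

Lemma tsection1 u : tsection (1 : aut m) u = 1.
Proof. exact: tsection_eq. Qed.

Lemma tsectionV f u : tsection f^-1 u = (tsection f (f^-1 u))^-1.
Proof.
apply/esym/mulg1_eq.
have fK : f (f^-1 u) = u by rewrite -autME mulVg.
by rewrite -[in tsection f^-1 _]fK -tsectionM mulgV tsection1.
Qed.

Lemma tsection_tsection f u v : tsection (tsection f u) v = tsection f (u ++ v).
Proof.
apply/esym/tsection_eq => z.
by rewrite -catA tsectionE (tsectionE (tsection f u)) catA -tsectionE.
Qed.

Lemma tsection_nil f : tsection f [::] = f.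
Proof. by apply: tsection_eq => z; rewrite aut_nil. Qed.

Lemma aut_letter f x : exists y, f [:: x] = [:: y].
Proof.
by case E: (f [:: x]) (size_aut f [:: x]) => [|y [|? ?]] //= _; exists y.
Qed.

Lemma st1J f g : st1 f -> st1 (f ^ g).
Proof.
move=> sf x; rewrite conjgE !autME.
have [y yE] := aut_letter g^-1 x.
by rewrite yE sf -yE -autME mulVg.
Qed.

Lemma st1_subgroup : is_subgroup (@st1 m).
Proof.
apply: mk_subgroup => // [f g sf sg|f sf] x; first by rewrite autME sf sg.
by rewrite -[in LHS]sf -autME mulgV.
Qed.

Lemma st1_normal G : is_subgroup G -> normal_in G (G `&` @st1 m).
Proof.
move=> sG; split=> [|f []//|f g [Gf sf] Gg].
  have ss := st1_subgroup.
  apply: mk_subgroup => [|f g [Gf sf] [Gg sg]|f [Gf sf]]; split => //.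
  - exact: subgroup1.
  - exact: subgroupM.
  - exact: (subgroupM ss).
  - exact: subgroupV.
  - exact: (subgroupV ss).
by split; [exact: subgroupJ|exact: st1J].
Qed.

Lemma psiM f g x : st1 f -> psi (f * g) x = psi f x * psi g x.
Proof. by rewrite /psi tsectionM => ->. Qed.

Lemma psi1 x : psi (1 : aut m) x = 1.
Proof. exact: tsection1. Qed.

Lemma psiV f x : st1 f -> psi f^-1 x = (psi f x)^-1.
Proof. by move=> sf; rewrite /psi tsectionV (subgroupV st1_subgroup sf). Qed.

Lemma psiJ f g x : st1 f -> st1 g -> psi (f ^ g) x = psi f x ^ psi g x.
Proof.
move=> sf sg; rewrite !conjgE !psiM ?psiV //; exact: (subgroupV st1_subgroup).
Qed.

Lemma psiR f g x : st1 f -> st1 g -> psi [~ f, g] x = [~ psi f x, psi g x].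
Proof.
move=> sf sg; rewrite !commgEl psiM ?psiV ?psiJ //; exact: (subgroupV st1_subgroup).
Qed.

Lemma psiX f k x : st1 f -> psi (f ^+ k) x = psi f x ^+ k.
Proof.
by move=> sf; elim: k => [|k IHk]; rewrite ?expg0 ?psi1 // !expgS psiM ?IHk.
Qed.

(** Sections of products and inverses are products and inverses of sections, so
    the elements all of whose sections are in a given subgroup form a subgroup. *)
Lemma generated_self_similar (A : set (aut m)) :
  (forall f u, A f -> generated A (tsection f u)) -> self_similar (generated A).
Proof.
move=> AA f u Gf; move: f Gf u.
have sG := generated_subgroup A.
suff : generated A `<=` [set f | forall u, generated A (tsection f u)] by [].
apply: generated_sub => [|f Af u]; last exact: AA.
apply: mk_subgroup => [u|f g Gf Gg u|f Gf u] /=.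
- by rewrite tsection1; exact: (subgroup1 sG).
- by rewrite tsectionM; exact: (subgroupM sG).
- by rewrite tsectionV; exact: (subgroupV sG).
Qed.

End TreeSections.

Lemma coprime_inv_mod k m : 0 < k -> coprime k m -> exists v, k * v = 1 %[mod m].
Proof.
move=> k0 /eqP km; case: (egcdnP m k0) => u v; rewrite km => E _.
by exists u; rewrite mulnC E modnMDl.
Qed.

(** * The GGS-group and the stabiliser of the first level *)

Section GGSBasics.
Local Open Scope classical_set_scope.
Local Open Scope group_scope.
Variable m' : nat.
Local Notation m := m'.+2.
Variable e : m.-1.-tuple 'Z_m.
Implicit Types (f g h s w : aut m) (x y r : 'I_m) (k : nat) (z : word m).

Local Notation a := (ggs_a m).
Local Notation b := (ggs_b e).
Local Notation G := (GGS e).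

Definition ev r : nat := entry e r.

Lemma ordS_add x : ordS x = (x + 1)%R.
Proof. by apply: val_inj; rewrite /= addn1. Qed.

Lemma natr_Zp_mod k l : k = l %[mod m] -> (k%:R = l%:R :> 'I_m)%R.
Proof. by move=> kl; apply: val_inj; rewrite !Zp_nat /= kl. Qed.

Lemma ggs_aX k x z : (a ^+ k) (x :: z) = (x + k%:R)%R :: z.
Proof.
elim: k => [|k IHk]; first by rewrite expg0 addr0.
by rewrite expgSr autME IHk /= ordS_add -addrA -natr1.
Qed.

Lemma ggs_aVX k x z : (a ^- k) (x :: z) = (x - k%:R)%R :: z.
Proof.
have -> : x :: z = (a ^+ k) ((x - k%:R)%R :: z) by rewrite ggs_aX subrK.
by rewrite -autME mulgV.
Qed.

Lemma ggs_aX_natr k l : (k%:R = l%:R :> 'I_m)%R -> a ^+ k = a ^+ l.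
Proof.
move=> kl; apply: aut_ext => -[|x z]; first by rewrite !aut_nil.
by rewrite !ggs_aX kl.
Qed.

Lemma ggs_aX_mod k l : k = l %[mod m] -> a ^+ k = a ^+ l.
Proof. by move=> kl; exact/ggs_aX_natr/natr_Zp_mod. Qed.

Lemma ggs_am : a ^+ m = 1.
Proof. by rewrite (@ggs_aX_mod m 0) // modnn mod0n. Qed.

Lemma tsection_aX k x z : tsection (a ^+ k) (x :: z) = 1.
Proof. by apply: tsection_eq => t; rewrite /= !ggs_aX. Qed.

Lemma psi_conj_a f k x : st1 f -> psi (f ^ (a ^+ k)) x = psi f (x - k%:R)%R.
Proof.
move=> sf; apply: tsection_eq => z.
rewrite conjgE !autME cat1s ggs_aVX -[_ :: z]cat1s tsectionE sf cat1s ggs_aX.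
by rewrite subrK ggs_aVX sf ggs_aX subrK.
Qed.

Lemma psi_b x : psi b x = if (x + 1)%R == 0%R then b else a ^+ ev (x + 1)%R.
Proof.
rewrite psi_ggs_b -ordS_add -val_eqE /=.
have := ltn_ord x; rewrite leq_eqVlt => /predU1P[->|xm].
  by rewrite modnn !eqxx.
by rewrite (ltn_eqF xm) /ev /= modn_small.
Qed.

(** The exponent is the index x.+1 of the letter x, so that b sits at x and the
    other sections depend on differences of letters only. *)
Definition bb x : aut m := b ^ (a ^+ x.+1).

Lemma bb_st1 x : st1 (bb x).
Proof. exact/st1J/ggs_b_st1. Qed.

Lemma psi_bb x y : psi (bb x) y = if y == x then b else a ^+ ev (y - x)%R.
Proof.
rewrite psi_conj_a ?psi_b; last exact: ggs_b_st1.
have -> : (y - x.+1%:R + 1)%R = (y - x)%R.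
  by rewrite -natr1 natr_Zp opprD addrA subrK.
by rewrite subr_eq0.
Qed.

Lemma psi_bb_diag x : psi (bb x) x = b.
Proof. by rewrite psi_bb eqxx. Qed.

Lemma psi_bb_off x y : y != x -> psi (bb x) y = a ^+ ev (y - x)%R.
Proof. by rewrite psi_bb => /negPf ->. Qed.

(** By induction on the word: b^m fixes the first letter, and its section there is
    either b^m again or the m-th power of a power of a. *)
Lemma ggs_bm : b ^+ m = 1.
Proof.
apply: aut_ext; elim=> [|x z IHz]; first by rewrite aut_nil.
rewrite -cat1s tsectionE (subgroupX (@st1_subgroup m) _ (ggs_b_st1 e)).
congr (_ :: _); rewrite -[tsection _ _]/(psi _ x) psiX; last exact: ggs_b_st1.
by rewrite psi_b; case: ifP => // _; rewrite -expgnA mulnC expgnA ggs_am expg1n.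
Qed.

Lemma GGS_subgroup : is_subgroup G.
Proof. exact: generated_subgroup. Qed.
Let sG := GGS_subgroup.

Lemma GGS_a : G a.
Proof. by apply: mem_generated; left. Qed.

Lemma GGS_b : G b.
Proof. by apply: mem_generated; right. Qed.

Lemma GGS_aX k : G (a ^+ k).
Proof. exact: (subgroupX sG _ GGS_a). Qed.

Lemma GGS_bb x : G (bb x).
Proof. exact: (subgroupJ sG GGS_b (GGS_aX _)). Qed.

Lemma GGS_gen : gen2 G a b.
Proof. by move=> H sH Ha Hb; apply: generated_sub => // g [->|->]. Qed.

Lemma GGS_gen_pow k : coprime k m -> gen2 G b (a ^+ k).
Proof.
move=> km H sH Hb Hak; apply: GGS_gen => //.
have k0 : (0 < k)%N by case: k km {Hak} => //; rewrite /coprime gcd0n.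
have [v kv] := coprime_inv_mod k0 km.
by rewrite -[a]expg1 -(ggs_aX_mod kv) expgnA; apply: (subgroupX sH).
Qed.

Lemma GGS_self_similar : self_similar G.
Proof.
have aXG k u : G (tsection (a ^+ k) u).
  case: u => [|x u]; first by rewrite tsection_nil; exact: GGS_aX.
  by rewrite tsection_aX; exact: (subgroup1 sG).
apply: generated_self_similar => f u [->|->]; first exact: (aXG 1%N).
elim: u => [|x u IHu]; first by rewrite tsection_nil; exact: GGS_b.
rewrite -cat1s -tsection_tsection -[tsection b _]/(psi b x) psi_b.
by case: ifP => // _; exact: aXG.
Qed.

Lemma GGS_psi f x : G f -> G (psi f x).
Proof. exact: GGS_self_similar. Qed.

Lemma derived_st1 : derived G `<=` G `&` @st1 m.
Proof.
apply: (gen2_derived_sub sG GGS_gen GGS_a GGS_b) (st1_normal sG) _.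
split; first exact: (subgroupR sG GGS_a GGS_b).
rewrite commgEr; apply: (subgroupM (@st1_subgroup m)); last exact: ggs_b_st1.
exact/st1J/(subgroupV (@st1_subgroup m))/ggs_b_st1.
Qed.

Variable r0 : 'I_m.
Hypotheses (r0_neq0 : r0 != 0%R) (r0_unit : coprime (ev r0) m).

(** The sections at x of b_x and of b_(x - r0) are b and a power of a that
    generates <a>. *)
Lemma psi_onto x g : G g -> exists s, [/\ G s, st1 s & psi s x = g].
Proof.
have ss := @st1_subgroup m.
suff : G `<=` [set g | exists s, [/\ G s, st1 s & psi s x = g]] by apply.
apply: (GGS_gen_pow r0_unit).
- apply: mk_subgroup => [|f h [s [Gs ss1 <-]] [t [Gt ts1 <-]]|f [s [Gs ss1 <-]]].
  + by exists 1; split; [exact: (subgroup1 sG)|exact: (subgroup1 ss)|exact: psi1].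
  + exists (s * t); split; [exact: (subgroupM sG)|exact: (subgroupM ss)|exact: psiM].
  + exists s^-1; split; [exact: (subgroupV sG)|exact: (subgroupV ss)|exact: psiV].
- by exists (bb x); split; [exact: GGS_bb|exact: bb_st1|exact: psi_bb_diag].
- exists (bb (x - r0)%R); split; [exact: GGS_bb|exact: bb_st1|].
  rewrite psi_bb_off; first by rewrite subKr.
  by rewrite -subr_eq0 subKr.
Qed.

(** A power of a corrects the first letter; an element of the first level
    stabiliser with prescribed section then corrects the rest of the word. *)
Lemma GGS_transitive : spherically_transitive G.
Proof.
elim=> [|l IHl] u v.
  move=> /size0nil -> /size0nil ->; exists 1; [exact: (subgroup1 sG)|exact: aut_nil].
case: u => // x u [ul]; case: v => // y v [vl].
have [g Gg guv] := IHl u v ul vl.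
have [s [Gs ss gE]] := psi_onto y Gg.
exists (a ^+ (y - x)%R * s); first exact: (subgroupM sG (GGS_aX _) Gs).
rewrite autME ggs_aX natr_Zp addrC subrK -cat1s tsectionE ss.
by rewrite -[tsection _ _]/(psi s y) gE guv.
Qed.

End GGSBasics.

(** * Branching over the second derived subgroup *)

Section Branching.
Local Open Scope classical_set_scope.
Local Open Scope group_scope.
Variable m' : nat.
Local Notation m := m'.+2.
Variable e : m.-1.-tuple 'Z_m.
Implicit Types (f g h s w : aut m) (x y r : 'I_m) (k : nat) (z : word m).
Implicit Types (N K : set (aut m)).

Local Notation a := (ggs_a m).
Local Notation b := (ggs_b e).
Local Notation G := (GGS e).
Local Notation bb := (bb e).
Local Notation ev := (ev e).
Let sG := GGS_subgroup e.
Let ss := @st1_subgroup m.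

(** The commutator of two elements of this kind, with different x, is supported at
    the letter 0 alone. *)
Definition sections0 N x : set (aut m) :=
  [set g | exists f, [/\ N f, st1 f, psi f 0%R = g
                       & forall y, y != 0%R -> y != x -> psi f y = 1]].

(** For a normal subgroup N of G, this is the projection to one letter of the rigid
    stabiliser in N of that letter; by rist_move the choice of the letter 0 is
    immaterial. *)
Definition rist N : set (aut m) := sections0 N 0%R.

Lemma ristP N g : rist N g <-> exists f,
  [/\ N f, st1 f, psi f 0%R = g & forall y, y != 0%R -> psi f y = 1].
Proof.
by split=> -[f [Nf sf fg f1]]; exists f; split=> // y y0 *; apply: f1.
Qed.

Lemma rist_mono N K : N `<=` K -> rist N `<=` rist K.
Proof. by move=> NK g [f [/NK Kf sf fg f1]]; exists f. Qed.

Lemma rist_move N f x g : normal_in G N -> N f -> st1 f -> psi f x = g ->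
  (forall y, y != x -> psi f y = 1) -> rist N g.
Proof.
move=> [_ _ nN] Nf sf fx f1; apply/ristP.
have fE y : psi (f ^ (a ^+ (- x)%R)) y = psi f (y + x)%R.
  by rewrite psi_conj_a // natr_Zp opprK.
exists (f ^ (a ^+ (- x)%R)); split.
- exact: (nN _ _ Nf (GGS_aX _)).
- exact: st1J.
- by rewrite fE add0r.
- by move=> y y0; rewrite fE f1 // -subr_eq0 addrK.
Qed.

(** Products, over distinct letters, of elements supported at a single letter. *)
Lemma psi_image_of_rist N : normal_in G N -> N `<=` rist N -> N `<=` @st1 m ->
  [set h : 'I_m -> aut m | forall x, N (h x)] `<=` @psi m @` N.
Proof.
move=> [sN NG nN] Nr Nst h Nh.
suff H (s : seq 'I_m) : uniq s -> exists2 f, N f &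
    forall y, psi f y = if y \in s then h y else 1.
  have [f Nf fE] := H _ (enum_uniq 'I_m).
  by exists f => //; apply/funext => y; rewrite fE mem_enum.
elim: s => [_|x s IHs /= /andP[xs /IHs[f Nf fE]]].
  by exists 1; [exact: (subgroup1 sN)|move=> y; rewrite psi1].
have [g [Ng sg gx g1]] := (ristP _ _).1 (Nr _ (Nh x)).
have gE y : psi (g ^ (a ^+ x)) y = if y == x then h y else 1.
  rewrite psi_conj_a // natr_Zp; case: eqVneq => [->|yx]; first by rewrite subrr.
  by rewrite g1 // subr_eq0.
exists (g ^ (a ^+ x) * f).
  exact: (subgroupM sN (nN _ _ Ng (GGS_aX _)) Nf).
move=> y; rewrite psiM ?gE ?fE; last exact: st1J.
rewrite in_cons; case: eqVneq => [->|yx] /=; last by rewrite mul1g.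
by rewrite (negPf xs) mulg1.
Qed.

Section Unit.
Variable i : 'I_m.
Hypotheses (iNi : i != (- i)%R) (i_unit : coprime (ev i) m).

Lemma unit_neq0 : i != 0%R.
Proof. by apply: contraNneq iNi => ->; rewrite oppr0. Qed.
Let i0 := unit_neq0.

(** Conjugation by an element of the first level stabiliser does not enlarge
    supports, and realises conjugation by any element of G at the letter 0. *)
Lemma sections0_normal N x : normal_in G N -> normal_in G (sections0 N x).
Proof.
move=> [sN NG nN]; split.
- apply: mk_subgroup => [|g h [f [Nf sf <- f1]] [f' [Nf' sf' <- f1']]|g [f [Nf sf <- f1]]].
  + by exists 1; split=> [|||y _ _]; rewrite ?psi1 //; exact: (subgroup1 sN).
  + exists (f * f'); split; [exact: (subgroupM sN)|exact: (subgroupM ss)|exact: psiM|].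
    by move=> y y0 yx; rewrite psiM // f1 // f1' // mulg1.
  + exists f^-1; split; [exact: (subgroupV sN)|exact: (subgroupV ss)|exact: psiV|].
    by move=> y y0 yx; rewrite psiV // f1 // invg1.
- by move=> _ [f [/NG Gf sf <- _]]; exact: GGS_psi.
- move=> _ g [f [Nf sf <- f1]] Gg.
  have [s [Gs ss1 <-]] := psi_onto i0 i_unit 0%R Gg.
  exists (f ^ s); split; [exact: nN|exact: st1J|exact: psiJ|].
  by move=> y y0 yx; rewrite psiJ // f1 // conj1g.
Qed.

Lemma rist_normal N : normal_in G N -> normal_in G (rist N).
Proof. exact: sections0_normal. Qed.

Let dN := derived_normal sG.

Lemma derived_sub_unit N : normal_in G N -> N [~ b, a ^+ ev i] -> derived G `<=` N.
Proof.
apply: gen2_derived_sub => //; [exact: GGS_gen_pow|exact: GGS_b|exact: GGS_aX].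
Qed.

Lemma bb_comm_derived x y : derived G [~ bb x, bb y].
Proof. by apply: mem_commutator; exact: GGS_bb. Qed.

Lemma bb_comm_st1 x y : st1 [~ bb x, bb y].
Proof. by apply: (subgroupR ss); exact: bb_st1. Qed.

Lemma psi_bb_comm_l x y : x != y -> psi [~ bb x, bb y] x = [~ b, a ^+ ev (x - y)%R].
Proof.
move=> xy; rewrite psiR ?psi_bb_diag ?psi_bb_off //; exact: bb_st1.
Qed.

Lemma psi_bb_comm_r x y : x != y -> psi [~ bb x, bb y] y = [~ a ^+ ev (y - x)%R, b].
Proof.
rewrite eq_sym => xy; rewrite psiR ?psi_bb_diag ?psi_bb_off //; exact: bb_st1.
Qed.

Lemma psi_bb_comm_off x y t : t != x -> t != y -> psi [~ bb x, bb y] t = 1.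
Proof.
move=> tx ty; rewrite psiR ?psi_bb_off //; try exact: bb_st1.
by apply/eqP/commgP/commuteX2.
Qed.

(** The commutator of b_0 and b_(-i) is supported on {0, -i} and its section
    [b, a^e_i] at 0 generates G' as a normal subgroup. *)
Lemma derived_sub_sections0_opp : derived G `<=` sections0 (derived G) (- i)%R.
Proof.
apply: derived_sub_unit; first exact: sections0_normal.
have ni0 : 0%R != (- i)%R by rewrite eq_sym oppr_eq0.
exists [~ bb 0%R, bb (- i)%R]; split.
- exact: bb_comm_derived.
- exact: bb_comm_st1.
- by rewrite psi_bb_comm_l // sub0r opprK.
- by move=> y y0 yi; rewrite psi_bb_comm_off.
Qed.

(** The commutator of b_i and b_0 is corrected at 0 by an element f supported on
    {0, -i}. Since i <> -i this does not affect the section [b, a^e_i] at i.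
    Conjugation by a power of a moves i to 0 and -i to -2i. *)
Lemma derived_sub_sections0_opp2 : derived G `<=` sections0 (derived G) (- i - i)%R.
Proof.
have [sd dG nd] := dN.
apply: derived_sub_unit; first exact: sections0_normal.
pose u := [~ bb i, bb 0%R].
have du : derived G u by exact: bb_comm_derived.
have su : st1 u by exact: bb_comm_st1.
have [f [df sf fE f1]] : sections0 (derived G) (- i)%R (psi u 0%R).
  apply: derived_sub_sections0_opp; rewrite psi_bb_comm_r //.
  by apply: mem_commutator; [exact: GGS_aX|exact: GGS_b].
have sf1 : st1 f^-1 by exact: (subgroupV ss).
have su1 : st1 (u * f^-1) by exact: (subgroupM ss).
have E y : psi ((u * f^-1) ^ (a ^+ (- i)%R)) y = psi u (y + i)%R * (psi f (y + i)%R)^-1.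
  by rewrite psi_conj_a // natr_Zp opprK psiM // psiV.
exists ((u * f^-1) ^ (a ^+ (- i)%R)); split.
- exact: (nd _ _ (subgroupM sd du (subgroupV sd df)) (GGS_aX _)).
- exact: st1J.
- by rewrite E add0r f1 // invg1 mulg1 psi_bb_comm_l // subr0.
- move=> y y0 yi; rewrite E.
  have yi0 : (y + i)%R != i by rewrite -subr_eq0 addrK.
  case: (eqVneq (y + i)%R 0%R) => [->|yi1]; first by rewrite fE mulgV.
  have yi2 : (y + i)%R != (- i)%R.
    by rewrite -subr_eq0 opprK; move: yi; rewrite -subr_eq0 opprD !opprK addrA.
  by rewrite f1 // psi_bb_comm_off // invg1 mulg1.
Qed.

(** Supports {0, -i} and {0, -2i} meet in 0, as i <> 0. *)
Lemma derived2_rist : derived (derived G) `<=` rist (derived (derived G)).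
Proof.
have ddN := derived2_normal sG.
apply: commutator_sub; first by have [] := rist_normal ddN.
move=> g h /derived_sub_sections0_opp[f [df sf <- f1]].
move=> /derived_sub_sections0_opp2[f' [df' sf' <- f1']].
apply/ristP; exists [~ f, f']; split.
- exact: mem_commutator.
- exact: (subgroupR ss).
- exact: psiR.
- move=> y y0; rewrite psiR //; have [yi|yi] := eqVneq y (- i)%R.
    rewrite f1' ?commg1 // yi -subr_eq0 opprD !opprK addrA addNr add0r.
    exact: i0.
  by rewrite f1 // comm1g.
Qed.


Lemma ev_unit_natr : ((ev i)%:R : 'I_m)%R != 0%R.
Proof.
rewrite Zp_nat -val_eqE /= -/(dvdn m (ev i)); apply/negP => /gcdn_idPr E.
by move: i_unit; rewrite /coprime E.
Qed.

(** Looking at the first letter, such an equality would force b = 1. *)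
Lemma b_notin_powers_a (s t : nat) : b * a ^+ s <> a ^+ t.
Proof.
move=> E; have Ea : a ^+ s = a ^+ t.
  apply: aut_ext => -[|x z]; first by rewrite !aut_nil.
  have : (b * a ^+ s) [:: x] = (a ^+ t) [:: x] by rewrite E.
  rewrite autME (ggs_b_st1 e) !ggs_aX => /eqP.
  by rewrite eqseq_cons andbT => /eqP/addrI ->.
have b1 : b = 1 by apply: (mulIg (a ^+ s)); rewrite mul1g E.
have : psi b (i - 1)%R = 1 by rewrite b1 psi1.
rewrite psi_b subrK (negPf i0) => /(congr1 (fun f : aut m => f [:: 0%R])).
by rewrite ggs_aX add0r => -[] /(congr1 val) /= E0; have := ev_unit_natr;
  rewrite -val_eqE /= E0 eqxx.
Qed.

Lemma bb_ratio_derived x y : derived G ((bb x)^-1 * bb y).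
Proof.
have [sd dG nd] := dN.
have bbE t : eqm (derived G) (bb t) b.
  apply: (eqmJ sG dN); last exact: GGS_b.
  by apply: mem_commutator; [exact: GGS_b|exact: GGS_aX].
have xV : eqm (derived G) (bb x)^-1 b^-1 by apply: (eqmV dN) => //; exact: GGS_bb.
apply: (eqm_in dN (y := b^-1 * b)); last by rewrite mulVg; exact: (subgroup1 sd).
by apply: (eqmM sG dN) => //; apply: (subgroupV sG); exact: GGS_bb.
Qed.

Lemma bb_oppr1 : bb (- 1)%R = b.
Proof.
by rewrite /bb (@ggs_aX_natr _ _ 0) ?expg0 ?conjg1 // -natr1 natr_Zp addNr.
Qed.

(** If G' is abelian, so are its sections at 0. They include c = b^-1 a^k with
    k = e_i and d = b^-1 b_y for every y. After the cancellation of b^-1, the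
    equation c d = d c is compared at the letter l = -1 - k, which a^k moves to
    the letter -1 that carries b: if y is neither -1 nor l, it says that b is a
    power of a. *)
Lemma derived2_neq1 : derived (derived G) <> [set 1].
Proof.
move=> dd1; set k := ev i; pose l := (- 1 - k%:R : 'I_m)%R.
have comm f g : derived G f -> derived G g -> f * g = g * f.
  move=> df dg; apply/commgP/eqP.
  by have : derived (derived G) [~ f, g] by [exact: mem_commutator]; rewrite dd1.
have [y y1 yl] : exists2 y : 'I_m, y != (- 1)%R & y != l.
  (* There is room for y: i - 1 and - i - 1 differ from each other and from -1. *)
  have [il|il] := eqVneq (i - 1)%R l; last first.
    by exists (i - 1)%R; rewrite // -subr_eq0 opprK subrK.
  exists (- i - 1)%R; first by rewrite -subr_eq0 opprK subrK oppr_eq0.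
  by rewrite -il (inj_eq (addIr _)) eq_sym.
have d1 : derived G ((bb 0%R)^-1 * bb (- i)%R) by exact: bb_ratio_derived.
have [f [df sf fE _]] := derived_sub_sections0_opp (bb_ratio_derived (- 1)%R y).
have := congr1 (fun g => psi g 0%R) (comm _ _ d1 df).
have sV x : st1 (bb x)^-1 by apply: (subgroupV ss); exact: bb_st1.
have ni0 : 0%R != (- i)%R by rewrite eq_sym oppr_eq0.
rewrite psiM; last by apply: (subgroupM ss) => //; exact: bb_st1.
rewrite [RHS]psiM // fE psiM // psiV; last exact: bb_st1.
rewrite psi_bb_diag psi_bb_off // sub0r opprK -/k bb_oppr1.
rewrite -[LHS]mulgA -[RHS]mulgA => /mulgI.
move=> /(congr1 (fun g => tsection g [:: l])).
rewrite tsectionM tsection_aX mul1g ggs_aX subrK.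
have sb : st1 b by exact: ggs_b_st1.
have sbV : st1 b^-1 by exact: (subgroupV ss).
rewrite -[tsection _ _]/(psi _ _) psiM // psiV //.
rewrite -[in psi b _]bb_oppr1 psi_bb_diag psi_bb_off 1?eq_sym //.
rewrite -[tsection _ [:: l]]/(psi _ l) (@psiM _ (bb y)); last exact: bb_st1.
rewrite (@psiM _ b^-1) // [psi (a ^+ k) l]tsection_aX mulg1.
rewrite psiV // psi_bb_off 1?eq_sym // psi_b ifN; last first.
  by rewrite addrAC addNr add0r oppr_eq0; exact: ev_unit_natr.
move: (ev _) (ev _) (ev _) => u v w.
rewrite (expg_inv_mod (ltn0Sn _) u (ggs_am m')) -expgnDr => E.
by apply: (@b_notin_powers_a (v + u * m.-1) w); rewrite -E mulVKg.
Qed.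

Lemma weakly_regular_branch_of_rist N : normal_in G N ->
  derived (derived G) `<=` N -> N `<=` derived G -> N `<=` rist N ->
  weakly_regular_branch G N.
Proof.
move=> NN ddN Nd Nr; have [sN NG _] := NN.
have Nst : N `<=` @st1 m by move=> f /Nd /derived_st1 [].
split.
- exact: GGS_transitive i0 i_unit.
- exact: GGS_self_similar.
- by split=> // f Nf; split; [exact: Nst|exact: NG].
- move=> N1; apply: derived2_neq1; apply/seteqP; split.
    by rewrite -N1.
  by move=> _ ->; have [sdd _ _] := derived2_normal sG; exact: (subgroup1 sdd).
- exact: psi_image_of_rist.
Qed.

Lemma derived2_weakly_regular_branch :
  weakly_regular_branch G (derived (derived G)).
Proof.
apply: weakly_regular_branch_of_rist => //.
- exact: derived2_normal.
- have [sd dG _] := dN; apply: commutator_sub => // f g /dG Gf /dG Gg.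
  exact: mem_commutator.
- exact: derived2_rist.
Qed.

End Unit.

End Branching.

(** * A rigidity property of vectors over the prime field *)

(** The vector E, extended by 0 at the index 0, is the defining vector modulo p,
    and V x y will say that a^(q x) b^(q y) centralises G' modulo the sections at 0
    of the elements of gamma_3(G) supported there. *)
Section FrobeniusRigidity.
Local Open Scope ring_scope.
Variables (p n m' : nat).
Local Notation m := m'.+2.
Hypotheses (p_prime : prime p) (mE : m = (p ^ n)%N).
Variables (E : 'I_m -> 'F_p) (V : 'F_p -> 'F_p -> Prop) (i : 'I_m).
Implicit Types (r s : 'I_m) (x y c : 'F_p).
Hypotheses (E0 : E 0 = 0) (iNi : i != - i) (Ei : E i != 0).
Hypotheses (V00 : V 0 0)
  (VD : forall x y x' y', V x y -> V x' y' -> V (x + x') (y + y')).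
Hypothesis V_shift : forall r s x y, E r != 0 -> s != 0 -> s != - r ->
  V (x * E (- r) + y * E s) 0 -> V (y * E (r + s)) x.
Hypothesis V_diag : forall r, E r != 0 -> V 0 1 -> V (E r) 0.
Hypothesis V_proper : ~ (V 1 0 /\ V 0 1).

Lemma V_scale c x y : V x y -> V (c * x) (c * y).
Proof.
move=> Vxy; rewrite -[c]natr_Zp; elim: (nat_of_ord c) => [|k IHk].
  by rewrite !mul0r.
by rewrite -natr1 !mulrDl !mul1r; apply: VD.
Qed.

Lemma notV01 : ~ V 0 1.
Proof.
move=> V01; apply: V_proper; split=> //.
by have := V_scale (E i)^-1 (V_diag Ei V01); rewrite mulVf // mulr0.
Qed.

Lemma E_neq0 r : E r != 0 -> r != 0.
Proof. by apply: contraNneq => ->; rewrite E0. Qed.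

Lemma exists_pm_neq r : exists2 s, s != r & (s == i) || (s == - i).
Proof.
have [ir|ir] := eqVneq i r; last by exists i; rewrite ?eqxx.
by exists (- i); rewrite ?eqxx ?orbT // -ir eq_sym.
Qed.

(** Otherwise the shift along r would take (0, 0) to (0, 1). *)
Lemma E_opp_neq0 r : E r != 0 -> E (- r) != 0.
Proof.
move=> Er; apply/eqP => Er0; apply: notV01.
have [s sr si] := exists_pm_neq (- r).
have s0 : s != 0 by case/orP: si => /eqP ->; rewrite ?oppr_eq0 E_neq0.
by have := @V_shift r s 1 0 Er s0 sr; rewrite Er0 mulr0 !mul0r add0r; apply.
Qed.

Lemma notV10 : ~ V 1 0.
Proof.
move=> V10; apply: notV01; have ENi := E_opp_neq0 Ei.
have := @V_shift i i (E (- i))^-1 0 Ei (E_neq0 Ei) iNi.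
rewrite mulVf // !mul0r addr0 => /(_ V10) /(V_scale (E (- i))).
by rewrite mulr0 mulfV.
Qed.

(** The coefficients make the vector on the left of the shift vanish. *)
Lemma V_relation r s : E r != 0 -> s != 0 -> s != - r ->
  V (- E (- r) * E (r + s)) (E s).
Proof. by move=> Er s0 sr; apply: V_shift => //; rewrite mulNr mulrC subrr. Qed.

(** V is a line through (- c, 1), so that V_relation becomes
    E (- r) * E (r + s) = c * E s. This makes W = E / c, with the value 1 at 0,
    multiplicative along the indices r with E r <> 0. Multiples of r by m vanish
    while x^m = x in F_p, hence W r = 1. *)
Lemma E_constant_closed : exists2 c, c != 0 &
  (forall r, E r != 0 -> E r = c) /\
  (forall r s, E r != 0 -> E s != 0 -> r + s != 0 -> E (r + s) != 0).
Proof.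
(* The relation for r = s = i, scaled; it needs i <> - i. *)
have [c Vc] : exists c, V (- c) 1.
  exists (E (- i) * E (i + i) / E i).
  have := V_scale (E i)^-1 (V_relation Ei (E_neq0 Ei) iNi).
  by rewrite mulVf // mulNr mulrN mulrC.
have c0 : c != 0 by apply/eqP => c0; apply: notV01; rewrite -[0]oppr0 -c0.
have Vuniq x y : V x y -> x = - c * y.
  move=> Vxy; apply/eqP; rewrite mulNr -addr_eq0; apply/negPn/negP => xy0.
  apply: notV10; have := V_scale (x + c * y)^-1 (VD Vxy (V_scale (- y) Vc)).
  by rewrite mulrNN mulr1 subrr mulr0 [y * c]mulrC mulVf.
have EE r s : E r != 0 -> s != 0 -> s != - r -> E (- r) * E (r + s) = c * E s.
  move=> Er s0 sr; apply: oppr_inj.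
  by rewrite -!mulNr; apply: Vuniq; apply: V_relation.
(* Multiply the relation for (r, s) by the one for (- r, r + s). *)
have EN r : E r != 0 -> E r * E (- r) = c ^+ 2.
  move=> Er; have [s sr si] := exists_pm_neq (- r).
  have Es : E s != 0 by case/orP: si => /eqP -> //; apply: E_opp_neq0.
  have s0 := E_neq0 Es.
  have E1 := EE _ _ Er s0 sr.
  have Ers : E (r + s) != 0.
    by have : c * E s != 0 by [rewrite mulf_neq0]; rewrite -E1 mulf_eq0 negb_or => /andP[].
  have /= := EE (- r) (r + s) (E_opp_neq0 Er) (E_neq0 Ers).
  rewrite opprK addKr => /(_ _) E2.
  have {}E2 : E r * E s = c * E (r + s).
    by apply: E2; rewrite -subr_eq0 addrC addKr.
  apply: (mulIf (mulf_neq0 Es Ers)).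
  transitivity ((E r * E s) * (E (- r) * E (r + s))); first by ring.
  by rewrite E1 E2; ring.
pose W s := if s == 0 then 1 else E s / c.
have WD r s : E r != 0 -> W (r + s) = W r * W s.
  move=> Er; rewrite /W (negPf (E_neq0 Er)).
  have [->|s0] := eqVneq s 0; first by rewrite addr0 (negPf (E_neq0 Er)) mulr1.
  have [rs0|rs0] := eqVneq (r + s) 0.
    have -> : s = - r by apply/eqP; rewrite -addr_eq0 addrC rs0.
    by rewrite mulf_div EN // -expr2 mulfV // expf_neq0.
  have sr : s != - r by rewrite -addr_eq0 addrC.
  apply: (mulfI (E_opp_neq0 Er)); rewrite [LHS]mulrA EE //.
  transitivity ((E r * E (- r)) * E s / c ^+ 2); last by field.
  by rewrite EN //; field.
have W1 r : E r != 0 -> W r = 1.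
  move=> Er; have WX k : W (r *+ k) = W r ^+ k.
    by elim: k => [|k IHk]; rewrite ?mulr0n /W ?eqxx // mulrS exprS -/(W _) WD ?IHk.
  have <- : W r ^+ m = W r.
    rewrite mE; elim: n => [|k IHk] //.
    rewrite expnSr exprM IHk.
    by have := expf_card (W r); rewrite card_Fp.
  have m0 : (m%:R : 'I_m) = 0 by apply: val_inj; rewrite Zp_nat /= modnn.
  by rewrite -WX -[r *+ _]mulr_natr m0 mulr0 /W eqxx.
have EW r : r != 0 -> W r = 1 -> E r = c.
  by move=> r0; rewrite /W (negPf r0) => /(canRL (mulfVK c0)); rewrite mul1r.
exists c => //; split=> [r Er|r s Er Es rs0].
  by apply: EW; [exact: E_neq0|exact: W1].
by rewrite (EW _ rs0) // WD // !W1 // mulr1.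
Qed.

End FrobeniusRigidity.

(** * Branching over the third term of the lower central series *)

Section Gamma3.
Local Open Scope classical_set_scope.
Local Open Scope group_scope.
Variable m' : nat.
Local Notation m := m'.+2.
Variable e : m.-1.-tuple 'Z_m.
Implicit Types (f g h w : aut m) (r s t : 'I_m) (k q x y : nat).

Local Notation a := (ggs_a m).
Local Notation b := (ggs_b e).
Local Notation G := (GGS e).
Local Notation bb := (bb e).
Local Notation ev := (ev e).
Let sG := GGS_subgroup e.
Let ss := @st1_subgroup m.
Let dN := derived_normal sG.
Let gN := gamma3_normal sG.

Variable i : 'I_m.
Hypotheses (iNi : i != (- i)%R) (i_unit : coprime (ev i) m).

Let A := rist (gamma 3 G).
Let Z := centmod G A (derived G).

Lemma ristgamma_normal : normal_in G A.
Proof. exact: (rist_normal iNi i_unit gN). Qed.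
Let AN := ristgamma_normal.

Lemma derived2_sub_rist : derived (derived G) `<=` A.
Proof.
exact: subset_trans (derived2_rist iNi i_unit) (rist_mono (derived2_sub_gamma3 sG)).
Qed.

Lemma centralizer_normal : normal_in G Z.
Proof. exact: centmod_normal. Qed.
Let ZN := centralizer_normal.

Lemma derived_sub_centralizer : derived G `<=` Z.
Proof.
have [_ dG _] := dN; move=> z dz; split=> [|g dg]; first exact: dG.
by apply: derived2_sub_rist; exact: mem_commutator.
Qed.
Let dZ := derived_sub_centralizer.

(** Let u = [b_r, b_0]. The commutator [u, w] lies in gamma_3 and is supported on
    {0, r}. Its section at 0 is in A because w is in Z there, and an element of
    gamma_3 supported at 0 removes it. The remaining section at r, which is
    [[b, a^e_r], w_r], is therefore in A; as [b, a^e_r] generates G' as a normal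
    subgroup and G'' <= A, the whole of G' commutes with w_r modulo A. *)
Lemma centralizer_shift w r : r != 0%R -> coprime (ev r) m ->
  G w -> st1 w -> Z (psi w 0%R) -> Z (psi w r).
Proof.
move=> r0 r_unit Gw sw [_ w0].
have [sd dG nd] := dN; have [sg gG ng] := gN; have [sA AG nA] := AN.
pose u := [~ bb r, bb 0%R].
have du : derived G u by exact: bb_comm_derived.
have su : st1 u by exact: bb_comm_st1.
have /ristP [f [gf sf fE f1]] : A [~ psi u 0%R, psi w 0%R].
  apply: w0; rewrite psi_bb_comm_r //.
  by apply: mem_commutator; [exact: GGS_aX|exact: GGS_b].
have suw : st1 [~ u, w] by exact: (subgroupR ss).
have sfV : st1 f^-1 by exact: (subgroupV ss).
have Ar : A [~ [~ b, a ^+ ev r], psi w r].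
  apply: (@rist_move _ e _ ([~ u, w] * f^-1) r) => //.
  - by apply: (subgroupM sg); [exact: mem_commutator|exact: (subgroupV sg)].
  - exact: (subgroupM ss).
  - by rewrite psiM // psiV // f1 // invg1 mulg1 psiR // psi_bb_comm_l // subr0.
  - move=> y yr; rewrite psiM // psiV //; have [->|y0] := eqVneq y 0%R.
      by rewrite fE psiR // mulgV.
    by rewrite f1 // invg1 mulg1 psiR // psi_bb_comm_off // comm1g.
have Gwr : G (psi w r) by exact: GGS_psi.
split=> //.
suff H : derived G `<=` [set g | derived G g /\ A [~ g, psi w r]].
  by move=> g /H [].
have dba : derived G [~ b, a ^+ ev r].
  by apply: mem_commutator; [exact: GGS_b|exact: GGS_aX].
apply: (gen2_derived_sub sG (GGS_gen_pow r_unit));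
  [exact: GGS_b|exact: GGS_aX| |by split].
split=> [|g [/dG]//|g h [dg Ag] Gh].
  apply: mk_subgroup => [|g h [dg Ag] [dh Ah]|g [dg Ag]]; split.
  - exact: (subgroup1 sd).
  - by rewrite comm1g; exact: (subgroup1 sA).
  - exact: (subgroupM sd).
  - by rewrite commgMl; apply: (subgroupM sA) => //; apply: nA => //; exact: dG.
  - exact: (subgroupV sd).
  - rewrite commgVl; apply: (subgroupV sA); apply: nA => //.
    by apply: (subgroupV sG); exact: dG.
split; first exact: nd.
(* The conjugate of w_r by h^-1 differs from w_r by an element of G', which
   commutes with g modulo G''. *)
have hV : G h^-1 by exact: (subgroupV sG).
rewrite -[psi w r](conjgKV h) -conjRg; apply: (nA) => //.
rewrite -(mulVKg (psi w r) (_ ^ h^-1)) -commgEl commgMr; apply: (subgroupM sA).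
  by apply: derived2_sub_rist; apply: mem_commutator => //; exact: mem_commutator.
by apply: nA => //; apply: dG; exact: mem_commutator.
Qed.

Lemma gamma3_sub_rist : Z a -> Z b -> gamma 3 G `<=` A.
Proof.
have [sA _ _] := AN; have [sZ _ _] := ZN.
move=> Za Zb; apply: commutator_sub => // h k dh Gk.
by have [_] := GGS_gen sZ Za Zb Gk; apply.
Qed.

Section Level.
Variable q : nat.
Let U x y := Z (a ^+ (q * x) * b ^+ (q * y)).

Let comm f g : G f -> G g -> eqm Z (f * g) (g * f).
Proof. by move=> *; apply: (eqm_comm sG ZN) => //; apply: dZ; exact: mem_commutator. Qed.

Let bX k : G (b ^+ k).
Proof. by apply: (subgroupX sG); exact: GGS_b. Qed.

Lemma levelD x y x' y' : U x y -> U x' y' -> U (x + x') (y + y').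
Proof.
have [sZ _ _] := ZN; move=> Uxy Uxy'.
apply: (eqm_in ZN _ (subgroupM sZ Uxy Uxy')).
rewrite !mulnDr !expgnDr -!mulgA; apply: (eqmM sG ZN); first exact: GGS_aX.
  exact: (eqm_refl ZN).
rewrite !mulgA; apply: (eqmM sG ZN).
- by apply: (subgroupM sG); [exact: GGS_aX|exact: bX].
- by apply: comm; [exact: GGS_aX|exact: bX].
- exact: (eqm_refl ZN).
Qed.

(** The shift property for the word b_r^(q x) b_(-s)^(q y): its section at 0 is a
    power of a, whereas at r the first factor contributes b^(q x). *)
Lemma level_shift r s x y : r != 0%R -> coprime (ev r) m ->
  s != 0%R -> s != (- r)%R ->
  U (x * ev (- r)%R + y * ev s) 0 -> U (y * ev (r + s)%R) x.
Proof.
move=> r0 r_unit s0 sr; rewrite /U muln0 expg0 mulg1 => U0.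
pose w := bb r ^+ (q * x) * bb (- s)%R ^+ (q * y).
have sb t : st1 (bb t) by exact: bb_st1.
have sbX t k : st1 (bb t ^+ k) by exact: (subgroupX ss).
have Gb t k : G (bb t ^+ k) by apply: (subgroupX sG); exact: GGS_bb.
have : Z (psi w r).
  apply: centralizer_shift => //; [exact: (subgroupM sG)|exact: (subgroupM ss)|].
  rewrite psiM // !psiX // !psi_bb_off ?sub0r ?opprK; last 2 first.
  - by rewrite eq_sym oppr_eq0.
  - by rewrite eq_sym.
  move: U0; congr Z; rewrite -!expgnA -expgnDr; congr (a ^+ _).
  by rewrite mulnDr !mulnA; congr addn; rewrite mulnC !mulnA.
rewrite psiM // !psiX // psi_bb_diag psi_bb_off; last first.
  by rewrite -addr_eq0 addrC addr_eq0.
rewrite opprK -expgnA => H; apply: (eqm_in ZN _ H).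
have -> : (q * (y * ev (r + s)%R) = ev (r + s)%R * (q * y))%N.
  by rewrite mulnA mulnC.
by apply: comm; [exact: GGS_aX|exact: bX].
Qed.

(** The shift property for b_0^q. *)
Lemma level_diag r : r != 0%R -> coprime (ev r) m -> U 0 1 -> U (ev r) 0.
Proof.
move=> r0 r_unit; rewrite /U !muln0 !expg0 mul1g mulg1 muln1 => U01.
have sb t : st1 (bb t) by exact: bb_st1.
have : Z (psi (bb 0%R ^+ q) r).
  apply: centralizer_shift => //.
  - by apply: (subgroupX sG); exact: GGS_bb.
  - exact: (subgroupX ss).
  - by rewrite psiX // psi_bb_diag.
by rewrite psiX // psi_bb_off // subr0 -expgnA mulnC.
Qed.

Variable p : nat.
Hypotheses (Zap : Z (a ^+ (q * p))) (Zbp : Z (b ^+ (q * p))).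

(** What makes the level-q relation a relation over F_p. *)
Lemma level_mod x y : U (x %% p) (y %% p) <-> U x y.
Proof.
have [sZ _ _] := ZN.
have mod_p g k : G g -> Z (g ^+ (q * p)) -> eqm Z (g ^+ (q * (k %% p))) (g ^+ (q * k)).
  move=> Gg Zg; rewrite [in X in eqm _ _ X](divn_eq k p) mulnDr expgnDr.
  rewrite -[X in eqm _ X _]mul1g; apply: (eqmM sG ZN); first exact: (subgroup1 sG).
    apply: (eqm_sym ZN); apply: eqm1.
    by rewrite [(_ * p)%N]mulnC mulnA expgnA; exact: (subgroupX sZ).
  exact: (eqm_refl ZN).
apply: (eqm_mem ZN); apply: (eqmM sG ZN); first exact: GGS_aX.
  by apply: mod_p => //; exact: GGS_a.
by apply: mod_p => //; exact: GGS_b.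
Qed.

End Level.

Section Descent.
Variables p n : nat.
Hypotheses (p_prime : prime p) (mE : m = (p ^ n)%N).

(** The entry at 0, where the section is b and not a power of a, is set to 0. *)
Definition evp r : 'F_p := if r == 0%R then 0%R else (ev r)%:R%R.

Lemma evp_unit r : evp r != 0%R -> (r != 0%R) && coprime (ev r) m.
Proof.
rewrite /evp; have [_|r0] := eqVneq r 0%R; first by rewrite eqxx.
rewrite -(dvdn_pcharf (pchar_Fp p_prime)) -prime_coprime //= mE coprime_sym => rp.
by apply: coprimeXr.
Qed.

Hypothesis not_rigid : ~ (exists2 c, c != 0%R &
  (forall r, evp r != 0%R -> evp r = c) /\
  (forall r s, evp r != 0%R -> evp s != 0%R -> (r + s)%R != 0%R ->
     evp (r + s)%R != 0%R)).

(** If the conclusion failed, the exponents (x, y) with a^(q x) b^(q y) in Z would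
    form a proper subspace of F_p^2 with the closure properties required by
    E_constant_closed. *)
Lemma descent_step q : Z (a ^+ (q * p)) -> Z (b ^+ (q * p)) ->
  Z (a ^+ q) /\ Z (b ^+ q).
Proof.
move=> Zap Zbp; have [sZ _ _] := ZN.
pose U x y := Z (a ^+ (q * x) * b ^+ (q * y)).
have i0 := unit_neq0 iNi.
pose V (c d : 'F_p) := U c d.
have VE x y : V x%:R%R y%:R%R <-> U x y.
  by rewrite /V !val_Fp_nat //; exact: level_mod.
have -> : (Z (a ^+ q) /\ Z (b ^+ q)) = (V 1%R 0%R /\ V 0%R 1%R).
  apply/propext; rewrite -[1%R]/(1%:R)%R -[0%R]/(0%:R)%R !VE /U.
  by rewrite muln0 muln1 !expg0 mul1g mulg1.
apply: contrapT => NV; apply: not_rigid.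
apply: (@E_constant_closed p n m' p_prime mE evp V i) => //.
- rewrite /evp (negPf i0) -(dvdn_pcharf (pchar_Fp p_prime)) -prime_coprime //.
  move: i_unit; rewrite mE coprime_sym; apply: coprime_dvdl.
  by apply: dvdn_exp => //; case: (n) mE.
- by apply/(VE 0 0); rewrite /U muln0 !expg0 mulg1; exact: (subgroup1 sZ).
- move=> c d c' d' Vcd Vcd'; rewrite -[c]natr_Zp -[d]natr_Zp -[c']natr_Zp -[d']natr_Zp.
  by rewrite -!natrD; apply/VE/levelD.
- move=> r s c d /evp_unit/andP[r0 r_unit] s0 sr.
  rewrite /evp oppr_eq0 (negPf r0) (negPf s0) -[c]natr_Zp -[d]natr_Zp -!natrM -natrD.
  rewrite (negPf (_ : (r + s)%R != 0%R)) ?(addrC r) ?addr_eq0 // -natrM.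
  by rewrite -[0%R]/(0%:R)%R => /VE H; apply/VE; rewrite addrC; exact: level_shift H.
- move=> r /evp_unit/andP[r0 r_unit] /(VE 0%N 1%N) H.
  rewrite /evp (negPf r0); apply/(VE _ 0); exact: level_diag.
Qed.

(** Descent steps from q = m, where a^m = b^m = 1, to q = 1. *)
Lemma nonrigid_gamma3_sub_rist : gamma 3 G `<=` rist (gamma 3 G).
Proof.
have [sZ _ _] := ZN.
suff H k : k <= n -> Z (a ^+ (p ^ (n - k))) /\ Z (b ^+ (p ^ (n - k))).
  by have [] := H n (leqnn n); rewrite subnn !expg1; exact: gamma3_sub_rist.
elim: k => [_|k IHk kn].
  by rewrite subn0 -mE ggs_am ggs_bm; split; exact: (subgroup1 sZ).
have [] := IHk (ltnW kn); rewrite -subSS subSn // expnSr; exact: descent_step.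
Qed.

Lemma nonrigid_regular_branch : regular_branch G (gamma 3 G).
Proof.
split.
  apply: weakly_regular_branch_of_rist iNi i_unit _ _ _ _ _ => //.
  - exact: derived2_sub_gamma3.
  - have [sd _ nd] := dN; apply: commutator_sub => // d g dd Gg.
    by rewrite commgEl; apply: (subgroupM sd); [exact: (subgroupV sd)|exact: nd].
  - exact: nonrigid_gamma3_sub_rist.
apply: (@gamma3_finite_index _ _ a b m) => //.
- exact: GGS_gen.
- exact: GGS_a.
- exact: GGS_b.
- exact: ggs_am.
- exact: ggs_bm.
Qed.

End Descent.

End Gamma3.

(** * From indices modulo m to the sets of vectors *)

Section Indices.
Variable m : nat.
Variable e : m.-1.-tuple 'Z_m.

Lemma GGS_derived2_branch j : 0 < j < m -> j.*2 != m -> coprime (entry e j) m ->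
  weakly_regular_branch (GGS e) (derived (derived (GGS e))).
Proof.
case: m e => [|[|m']] e' /andP[j0 jm] j2 ju; [by []|by case: j j0 jm {j2 ju}|].
apply: (@derived2_weakly_regular_branch _ _ (Ordinal jm)) => //.
rewrite -addr_eq0 -val_eqE /= addnn; apply: contra j2 => /dvdnP[[|[|k]]]; nia.
Qed.

(** The form in which the obstruction to the descent reaches the indices: 0 and the
    indices in Y form a subgroup of Z/m, and the vector is constant on Y modulo p. *)
Definition rigid p :=
  (forall i j, 0 < i < m -> 0 < j < m ->
     ~~ (p %| entry e i) -> ~~ (p %| entry e j) -> entry e i = entry e j %[mod p])
  /\ (forall i j, 0 < i < m -> 0 < j < m ->
     ~~ (p %| entry e i) -> ~~ (p %| entry e j) ->
     (i + j) %% m != 0 -> ~~ (p %| entry e ((i + j) %% m))).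

End Indices.

Lemma GGS_gamma3_branch m p n (e : m.-1.-tuple 'Z_m) j : prime p -> m = p ^ n ->
  0 < j < m -> j.*2 != m -> coprime (entry e j) m -> ~ rigid e p ->
  regular_branch (GGS e) (gamma 3 (GGS e)).
Proof.
case: m e => [|[|m']] e p_prime mE /andP[j0 jm] j2 ju nR;
  [by []|by case: j j0 jm {j2 ju}|].
apply: (@nonrigid_regular_branch _ _ (Ordinal jm) _ _ p n p_prime mE) => //.
  rewrite -addr_eq0 -val_eqE /= addnn; apply: contra j2 => /dvdnP[[|[|k]]]; nia.
have evpE (x : 'I_m'.+2) : 0 < x -> evp e p x = ((entry e x : nat)%:R : 'F_p)%R.
  by move=> x0; rewrite /evp ifN //; apply: contraTneq x0 => ->.
have evp0 (x : 'I_m'.+2) : 0 < x -> (evp e p x != 0)%R = ~~ (p %| entry e x).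
  by move=> x0; rewrite evpE // (dvdn_pcharf (pchar_Fp p_prime)).
move=> [c c0 [Ec Ed]]; apply: nR; split=> [x y|x y] /andP[x0 xm] /andP[y0 ym] xp yp.
  have := Ec (Ordinal xm); have := Ec (Ordinal ym).
  rewrite !evp0 // !evpE // => /(_ yp) yc /(_ xp); rewrite -yc.
  by move=> /(congr1 val); rewrite /= !val_Fp_nat.
move=> xy0; have xyE : val (Ordinal xm + Ordinal ym)%R = (x + y) %% m'.+2 by [].
have xy_gt0 : 0 < (Ordinal xm + Ordinal ym)%R by rewrite xyE lt0n.
have := Ed (Ordinal xm) (Ordinal ym); rewrite (evp0 _ xy_gt0) !evp0 // => /(_ xp yp).
rewrite -[in X in X -> _]val_eqE xyE; apply.
exact: xy0.
Qed.

Section Vectors.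
Variables p n : nat.
Hypotheses (p_prime : prime p) (n_gt0 : 0 < n).
Variable e : (p ^ n).-1.-tuple 'Z_(p ^ n).

Lemma Fset_Yset : Fset e -> exists j, Yset e j.
Proof.
move=> Fe; apply: contrapT => nY; apply: Fe => i im; apply/negPn/negP => ip.
by apply: nY; exists i.
Qed.

Lemma texp_lt : texp e < n.
Proof.
rewrite /texp; elim/big_ind: _ => // x y xn yn.
by rewrite gtn_max xn.
Qed.

Lemma texp_dvd j : Yset e j -> p ^ texp e %| j.
Proof.
move=> Yj; suff : [pred s | p ^ s %| j] (texp e) by [].
rewrite /texp; elim/big_ind: _ => [|x y xj yj|s /asboolP] /=.
- by rewrite dvd1n.
- by rewrite /maxn; case: ifP.
- by apply.
Qed.

Lemma texp_max s : s < n -> (forall i, Yset e i -> p ^ s %| i) -> s <= texp e.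
Proof.
move=> sn sY; rewrite /texp.
by apply: (@leq_bigmax_cond _ _ _ (Ordinal sn)); apply/asboolP.
Qed.

Lemma Yset_unit j : Yset e j -> coprime (entry e j) (p ^ n).
Proof.
by move=> [_ jp]; rewrite coprime_sym coprimeXl // prime_coprime.
Qed.

Lemma Yset_texp_exact : Fset e -> exists2 y, Yset e y & ~~ (p ^ (texp e).+1 %| y).
Proof.
move=> /Fset_Yset[j Yj]; apply: contrapT => nY.
have allY y : Yset e y -> p ^ (texp e).+1 %| y.
  by move=> Yy; apply/negPn/negP => ny; apply: nY; exists y.
have := texp_lt; rewrite leq_eqVlt => /predU1P[tn|/texp_max/(_ allY)].
  have := allY _ Yj; rewrite tn; have [/andP[j0 jn] _] := Yj.
  by move=> /(dvdn_leq j0); rewrite leqNgt jn.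
by rewrite ltnn.
Qed.

(** Some y in Y is u p^t with u prime to p, t being texp e. Closure under addition
    puts all its non-zero multiples modulo p^n in Y, and these are all the
    non-zero multiples of p^t. *)
Lemma rigid_Eset : Fset e -> rigid e p -> Eset e.
Proof.
move=> Fe [constY closedY]; split=> //; last first.
  by move=> i j [im ip] [jm jp]; apply: constY.
set t := texp e; have tn : t < n := texp_lt.
have pn : p ^ n = p ^ (n - t) * p ^ t by rewrite -expnD subnK // ltnW.
have pt0 : 0 < p ^ t by rewrite expn_gt0 prime_gt0.
apply/seteqP; split=> [y Yy|_ [k /andP[k0 kn] ->]].
  have [k yE] := dvdnP (texp_dvd Yy); exists k => //.
  have [/andP[y0 yn] _] := Yy; move: y0 yn; rewrite yE pn ltn_pmul2r // => y0 ->.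
  by rewrite andbT; case: k y0 {yE}.
have [y Yy ny] := Yset_texp_exact Fe.
have [u yE] := dvdnP (texp_dvd Yy).
have up : coprime u p.
  by rewrite coprime_sym prime_coprime //; apply: contra ny; rewrite yE expnS dvdn_pmul2r.
have u0 : 0 < u by case: Yy => /andP[]; rewrite yE; case: (u).
have [v uv] := coprime_inv_mod u0 (coprimeXr (n - t) up).
have multY l : (l * y) %% p ^ n != 0 -> Yset e ((l * y) %% p ^ n).
  have lt l' : (l' * y) %% p ^ n < p ^ n by rewrite ltn_mod expn_gt0 prime_gt0.
  have [yn yp] := Yy.
  elim: l => [|l IHl]; first by rewrite mul0n mod0n.
  rewrite mulSn addnC -modnDml; have [->|l0] := eqVneq ((l * y) %% p ^ n) 0.
    by rewrite add0n modn_small //; case/andP: yn.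
  have [_ lp] := IHl l0; move=> ly0; split.
    by rewrite lt0n ly0 ltn_mod expn_gt0 prime_gt0.
  by apply: closedY => //; rewrite lt0n l0 lt.
have kE : (k * v * y) %% p ^ n = k * p ^ t.
  rewrite yE mulnA pn -muln_modl -mulnA [v * u]mulnC -modnMmr uv modnMmr muln1.
  by rewrite modn_small.
by rewrite -kE; apply: multY; rewrite kE -lt0n muln_gt0 k0.
Qed.

(** The only index with 2 j = p^n is 2^(n-1), which is divisible by p^(n-1). *)
Lemma involutive_Yset j : Yset e j -> (forall i, Yset e i -> i.*2 = p ^ n) ->
  p = 2 /\ texp e = n.-1.
Proof.
move=> Yj Y2.
have p2 : p = 2.
  have : 2 %| p ^ n by rewrite -(Y2 _ Yj) -muln2 dvdn_mull.
  by rewrite Euclid_dvdX // => /andP[]; rewrite dvdn_prime2 // => /eqP.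
split=> //; apply/eqP; rewrite eqn_leq -ltnS prednK // texp_lt.
apply: texp_max => [|i /Y2]; first by rewrite prednK.
rewrite p2 -[in RHS](prednK n_gt0) expnS mul2n => /double_inj ->.
exact: dvdnn.
Qed.

(** Y then has at most one element, whose double is 0 modulo p^n. *)
Lemma rigid_of_involutive : (forall i, Yset e i -> i.*2 = p ^ n) -> rigid e p.
Proof.
move=> Y2; have eqY i j : 0 < i < p ^ n -> 0 < j < p ^ n ->
    ~~ (p %| entry e i) -> ~~ (p %| entry e j) -> i = j.
  move=> im jm ip jp; apply: double_inj.
  by rewrite (Y2 i) // (Y2 j).
split=> i j im jm ip jp; first by rewrite (eqY i j).
by rewrite (eqY i j) // addnn Y2 // modnn.
Qed.

End Vectors.

Theorem theorem1 (p n : nat) (e : (p ^ n).-1.-tuple 'Z_(p ^ n)) :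
  prime p -> 1 <= n -> Fset e ->
  let G := GGS e in
  (~ (p = 2 /\ Eprime e) -> weakly_regular_branch G (derived (derived G)))
  /\ (~ Eset e -> regular_branch G (gamma 3 G)).
Proof.
move=> p_prime n_gt0 Fe G; have [j Yj] := Fset_Yset Fe.
have find : ~ (forall i, Yset e i -> i.*2 = p ^ n) ->
    exists2 i, Yset e i & i.*2 != p ^ n.
  move=> nY; apply: contrapT => nE; apply: nY => i Yi; apply/eqP/negPn/negP => i2.
  by apply: nE; exists i.
split=> [nE'|nE].
  have [i Yi i2] : exists2 i, Yset e i & i.*2 != p ^ n.
    apply: find => Y2; apply: nE'.
    by have [p2 tE] := involutive_Yset p_prime n_gt0 Yj Y2.
  by apply: (GGS_derived2_branch _ i2 (Yset_unit p_prime Yi)); case: Yi.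
have nR : ~ rigid e p by move=> R; apply: nE; apply: rigid_Eset.
have [i Yi i2] : exists2 i, Yset e i & i.*2 != p ^ n.
  by apply: find => Y2; apply: nR; apply: rigid_of_involutive.
apply: (GGS_gamma3_branch p_prime erefl _ i2 (Yset_unit p_prime Yi) nR).
by case: Yi.
Qed.
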